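(* For every choice of primitive admissible parameters $(\delta,K_1,K_2,C_0,C_1)$, the class $\overrightarrow{\mathcal A}^\delta_{K_1,K_2,C_0,C_1}$ of all free orderings of members of $\mathcal A^\delta_{K_1,K_2,C_0,C_1}$ is a Ramsey class and has the expansion property with respect to $\mathcal A^\delta_{K_1,K_2,C_0,C_1}$.
   Context: $\mathcal A^\delta_{K_1,K_2,C_0,C_1}$ is the class of finite metric spaces with integer distances in $\{1,\dots,\delta\}$ such that for every triangle with perimeter $p$ and shortest side $m$: if $p$ odd then $2K_1<p<2K_2+2m$ and $p<C_1$; if $p$ even then $p<C_0$. With $C=\min(C_0,C_1)$, $C'=\max(C_0,C_1)$, parameters are primitive admissible if: $3\le\delta<\infty$; $1\le K_1\le K_2\le 2\delta$; $2\delta<C_0,C_1\le3\delta+2$, $C_0$ even, $C_1$ odd; $C_0,C_1\ge 2\delta+2$; and either (II) $C\le 2\delta+K_1$, $C=2K_1+2K_2+1$, $K_1+K_2\ge\delta$, $K_1+2K_2\le 2\delta-1$, and ($C'=C+1$, or $C'>C+1$, $K_1=K_2$, $3K_2=2\delta-1$); or (III) $C>2\delta+K_1$, $K_1+2K_2\ge2\delta-1$, $3K_2\ge2\delta$, if $K_1+2K_2=2\delta-1$ then $C\ge2\delta+K_1+2$, and if $C'>C+1$ then $C\ge 2\delta+K_2$. A free ordering of a metric space is its expansion by an arbitrary linear order of its points. A class $\mathcal C$ is Ramsey if for all $\mathbf A,\mathbf B\in\mathcal C$ and $k\ge1$ there is $\mathbf C\in\mathcal C$ such that for every $k$-colouring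 of the copies (substructures isomorphic to) $\mathbf A$ in $\mathbf C$ there is a copy $\widetilde{\mathbf B}$ of $\mathbf B$ in $\mathbf C$ all of whose copies of $\mathbf A$ have the same colour. A class $\mathcal K^+$ of expansions of structures in $\mathcal K$ has the expansion property (with respect to $\mathcal K$) if for every $\mathbf A\in\mathcal K$ there is $\mathbf B\in\mathcal K$ such that every expansion of $\mathbf A$ in $\mathcal K^+$ embeds into every expansion of $\mathbf B$ in $\mathcal K^+$. *)

(* Defs.v *)
From HB Require Import structures.
From mathcomp Require Import all_boot.

Set Implicit Arguments.
Unset Strict Implicit.
Unset Printing Implicit Defensive.

Record intMetric := IntMetric {
  point :> finType;
  dist : point -> point -> nat;
  dist_eq0 : forall x y, dist x y = 0 <-> x = y;
  dist_sym : forall x y, dist x y = dist y x;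
  dist_triangle : forall x y z, dist x z <= dist x y + dist y z
}.

Definition in_classA (delta K1 K2 C0 C1 : nat) (M : intMetric) : Prop :=
  (forall x y : M, x != y -> 1 <= dist x y <= delta) /\
  (forall x y z : M, x != y -> y != z -> x != z ->
     let p := dist x y + dist y z + dist x z in
     let m := minn (dist x y) (minn (dist y z) (dist x z)) in
     (odd p -> [/\ 2 * K1 < p, p < 2 * K2 + 2 * m & p < C1]) /\
     (~~ odd p -> p < C0)).

(* The truncated subtraction in 2 * delta - 1 is exact since 3 <= delta. *)
Definition caseII (delta K1 K2 C C' : nat) : Prop :=
  [/\ C <= 2 * delta + K1,
      C = 2 * K1 + 2 * K2 + 1,
      K1 + K2 >= delta,
      K1 + 2 * K2 <= 2 * delta - 1
    & C' = C + 1 \/ [/\ C' > C + 1, K1 = K2 & 3 * K2 = 2 * delta - 1]].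

Definition caseIII (delta K1 K2 C C' : nat) : Prop :=
  [/\ C > 2 * delta + K1,
      K1 + 2 * K2 >= 2 * delta - 1,
      3 * K2 >= 2 * delta,
      K1 + 2 * K2 = 2 * delta - 1 -> C >= 2 * delta + K1 + 2
    & C' > C + 1 -> C >= 2 * delta + K2].

Definition primitive_admissible (delta K1 K2 C0 C1 : nat) : Prop :=
  let C := minn C0 C1 in
  let C' := maxn C0 C1 in
  3 <= delta /\
  [/\ 1 <= K1, K1 <= K2 & K2 <= 2 * delta] /\
  (2 * delta < C0 <= 3 * delta + 2) /\
  (2 * delta < C1 <= 3 * delta + 2) /\
  ~~ odd C0 /\ odd C1 /\
  2 * delta + 2 <= C0 /\ 2 * delta + 2 <= C1 /\
  (caseII delta K1 K2 C C' \/ caseIII delta K1 K2 C C').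

(* Expansions of metric spaces by one binary relation. *)
Record expansion := Expand {
  reduct :> intMetric;
  ordle : rel reduct
}.

(* [total] includes reflexivity, so [r] is a non-strict linear order. *)
Definition linear_order (T : Type) (r : rel T) : Prop :=
  [/\ antisymmetric r, transitive r & total r].

Definition free_orderings (K : intMetric -> Prop) (A : expansion) : Prop :=
  K (reduct A) /\ linear_order (@ordle A).

Definition embedding (A B : expansion) (f : A -> B) : Prop :=
  [/\ injective f,
      forall x y, dist (f x) (f y) = dist x y
    & forall x y, ordle (f x) (f y) = ordle x y].

Definition embeds (A B : expansion) : Prop := exists f : A -> B, embedding f.

(* A substructure of [X] is given by its set of points; [S] is a copy of [A]
   when some map is an isomorphism from [A] onto the substructure on [S]. *)
Definition is_copy (A X : expansion) (S : {set X}) : Prop :=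
  exists f : A -> X, embedding f /\ [set f x | x : A] = S.

(* Only the values of the colouring [chi] on copies of [A] matter. *)
Definition ramsey (K : expansion -> Prop) : Prop :=
  forall A B : expansion, K A -> K B -> forall k : nat, 1 <= k ->
  exists X : expansion, K X /\
    forall chi : {set X} -> 'I_k,
    exists S : {set X}, is_copy B S /\
      forall S1 S2 : {set X},
        S1 \subset S -> is_copy A S1 -> S2 \subset S -> is_copy A S2 ->
        chi S1 = chi S2.

Definition expansion_property
    (Kplus : expansion -> Prop) (K : intMetric -> Prop) : Prop :=
  forall A : intMetric, K A ->
  exists B : intMetric, K B /\
    forall (r : rel A) (s : rel B),
      Kplus (Expand r) -> Kplus (Expand s) -> embeds (Expand r) (Expand s).

(* Main.v *)
(* Call a word of distances good if the closed walk that it labels occurs in a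
   member of the class; since the class has the four-point amalgamation
   property, this can be decided by composing allowed triangles.

   Starting from Ramsey's theorem, repeat the partite construction of Nesetril
   and Rodl with the Hales-Jewett theorem.  Each round projects onto the previous
   one, and a closed walk of length n + 1 either lies in a copy of the previous
   picture or is cut by a chord of a copy of A into two closed walks whose
   projections have length at most n.  Hence after n rounds one has a partial
   edge-labelled graph with the Ramsey property all of whose closed walks of
   length at most n are good.

   Such a graph completes to a member of the class as soon as n is large compared
   with delta.  Fix a magic distance M.  Pairs get their labels in the order
   delta, 1, delta - 1, 2, ... moving towards M, whenever the triangle inequality
   or the perimeter bound C keeps them away from M, and the remaining pairs get
   M.  An added edge unfolds into a walk of bounded length, and a forbidden
   triangle of the completion would unfold into a bad closed walk.

   For the expansion property, colour pairs of points at distance a by whether a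
   second linear order agrees with the first.  On a monochromatic copy the sign
   depends on a only, and triangles M, M, a show that it is the same for all a. *)
Require Import Defs.
From HB Require Import structures.
From mathcomp Require Import all_boot.
From mathcomp Require Import zify.

Set Implicit Arguments.
Unset Strict Implicit.
Unset Printing Implicit Defensive.

(** * Labels *)

Section MagicParameter.

Variables d K1 K2 c0 c1 C M : nat.

(* Triangle constraints of the class with [C0 = 2 c0] and [C1 = 2 c1 + 1]; [h]
   is the half perimeter.  For labels at most [d < c0] the label [0] acts as an
   identity: [allowed a 0 c] holds iff [a = c]. *)
Definition allowed (a b c : nat) : Prop :=
  (a <= b + c /\ b <= a + c /\ c <= a + b) /\
  exists h, (a + b + c = 2 * h /\ h < c0) \/
    (a + b + c = 2 * h + 1 /\ K1 <= h < c1 /\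
     h < K2 + a /\ h < K2 + b /\ h < K2 + c).

(* [M] is a magic distance: [M], [M], [a] is a triangle for every [a <= d], and
   [cIII] tells case (III) from case (II).  In the two borderline situations of
   case (III) where the two-sided bounds on [M] do not suffice, the strict
   inequalities [K1 < M] and [M < K2] are required. *)
Definition magic (cIII : bool) : Prop :=
  (3 <= d /\ 1 <= K1 /\ 2 * d + 2 <= C) /\
  (K1 <= M /\ d <= 2 * M /\ M <= K2 /\ 2 * M + d < C /\ M <= d) /\
  ((C = 2 * c0 /\ c0 <= c1) \/ (C = 2 * c1 + 1 /\ c1 < c0)) /\
  if cIII then
    C > 2 * d + K1 /\ K1 + 2 * K2 >= 2 * d - 1 /\ 3 * K2 >= 2 * d /\
    (K1 + 2 * K2 = 2 * d - 1 -> C >= 2 * d + K1 + 2 /\ K1 < M) /\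
    (c0 = c1 \/ c0 = c1.+1 \/ C > 2 * d + K2 \/ (C = 2 * d + K2 /\ M < K2))
  else
    C <= 2 * d + K1 /\ C = 2 * c1 + 1 /\ c1 = K1 + K2 /\ K1 + K2 >= d /\
    K1 + 2 * K2 <= 2 * d - 1 /\
    (c0 = c1.+1 \/ c0 > c1.+1 /\ K1 = K2 /\ M = K2 /\ 3 * K2 = 2 * d - 1).

Lemma halfP s : exists h, s = 2 * h \/ s = 2 * h + 1.
Proof. by exists s./2; lia. Qed.

(** Amalgamation of labels is a finite case analysis: once each parity and each alternative of
    [magic] is split, only linear arithmetic remains. *)
Ltac prep := repeat match goal with
  | H : allowed _ _ _ |- _ => destruct H as [? [? [[? ?]|[? ?]]]]
  | H : magic true |- _ =>
     destruct H as ((?&?&?)&(?&?&?&?&?)&[[? ?]|[? ?]]&?&?&?&?&[?|[?|[?|[? ?]]]])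
  | H : magic false |- _ =>
     destruct H as ((?&?&?)&(?&?&?&?&?)&?&?&?&?&?&?&[?|(?&?&?&?)])
  | H : magic ?b |- _ => is_var b; destruct b end.

Ltac allow := split; [lia|
  match goal with |- exists h, ?s = _ /\ _ \/ _ =>
    let k := fresh "k" in let H := fresh in
    destruct (halfP s) as [k [H|H]]; exists k; [left|right] end; lia].

Lemma allowed_rot a b c : allowed a b c -> allowed b c a.
Proof. by move=> [? [h ?]]; split; [lia|exists h; lia]. Qed.

Lemma allowed_swap a b c : allowed a b c -> allowed b a c.
Proof. by move=> [? [h ?]]; split; [lia|exists h; lia]. Qed.

Lemma allowed_rev a b c : allowed a b c -> allowed c b a.
Proof. by move=> [? [h ?]]; split; [lia|exists h; lia]. Qed.

Lemma allowed_refl cIII a : magic cIII -> a <= d -> allowed a a 0.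
Proof. by move=> [? [? [? _]]] ?; split; [lia|exists a; lia]. Qed.

(** For an odd perimeter, [K1 <= M] gives the lower bound and [M <= K2] the upper bounds at [a] and
    [b]. The upper bound at [M] comes from [K1 + 2 * K2 >= 2 * d - 1] in case (III), with [K1 < M]
    on equality, and from the value of [C] in case (II). *)
Lemma allowed_magic cIII a b : magic cIII -> a <= d -> b <= d ->
  b <= a + M -> a <= b + M -> M <= a + b -> M + a + b < C -> allowed a b M.
Proof. by move=> P ad bd Hc He Hx A; prep; allow. Qed.

(** A quadrilateral has the known diagonal [x] and the unknown one [y]. Here the triangle inequality
    keeps [y] above [M], and the least possible value is taken. The next two lemmas treat upper
    bounds below [M], from the triangle inequality and from the perimeter. *)
Lemma diagonal_minus cIII a b c e x y : magic cIII ->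
  a <= d -> b <= d -> c <= d -> e <= d -> x <= d ->
  allowed a b x -> allowed x c e ->
  b = c + y -> a <= e + y -> e <= a + y -> M < y ->
  allowed b c y /\ allowed a y e.
Proof.
by move=> P *; prep; (split; allow).
Qed.

Lemma diagonal_plus cIII a b c e x y : magic cIII ->
  a <= d -> b <= d -> c <= d -> e <= d -> x <= d ->
  allowed a b x -> allowed x c e ->
  b + c = y -> y <= a + e -> y < M -> a <= e + M -> e <= a + M ->
  a + e + b + c < C -> allowed b c y /\ allowed a y e.
Proof.
by move=> P *; prep; (split; allow).
Qed.

Lemma diagonal_C cIII a b c e x y : magic cIII ->
  a <= d -> b <= d -> c <= d -> e <= d -> x <= d ->
  allowed a b x -> allowed x c e ->
  C = y + 1 + b + c -> a + e <= b + c -> y < M -> b <= c + M -> c <= b + M ->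
  a <= e + M -> e <= a + M -> y <= a + e -> allowed b c y /\ allowed a y e.
Proof.
by move=> P *; prep; (split; allow).
Qed.

(* Four-point amalgamation: the missing diagonal is the admissible value
   closest to [M]. *)
Lemma allowed_assoc cIII a b c e x : magic cIII ->
  a <= d -> b <= d -> c <= d -> e <= d -> x <= d ->
  allowed a b x -> allowed x c e ->
  exists y, [/\ y <= d, allowed b c y & allowed a y e].
Proof.
move=> P ad bd cd ed xd abx xce.
have bax := allowed_swap abx; have xec := allowed_rev (allowed_rot xce).
have ecx := allowed_rev xce; have xba := allowed_rev abx.
have cex := allowed_swap ecx; have xab := allowed_rev bax.
have md : M <= d by case: P; lia.
(* By the symmetries of the quadrilateral, the two sides that give the decisive bound may be assumed
   to be [b] and [c], in either order. *)
suff [[y [y0 y1 y2]]|[[y [y0 y1 y2]]|[[y [y0 y1 y2]]|[y [y0 y1 y2]]]]] :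
   (exists y, [/\ y <= d, allowed b c y & allowed a y e]) \/
   (exists y, [/\ y <= d, allowed c b y & allowed e y a]) \/
   (exists y, [/\ y <= d, allowed a e y & allowed b y c]) \/
   (exists y, [/\ y <= d, allowed e a y & allowed c y b]).
- by exists y.
- by exists y; split=> //; [apply: allowed_swap|apply: allowed_rev].
- by exists y; split=> //; apply: allowed_rev; apply: allowed_rot;
    rewrite //; apply: allowed_rev; apply: allowed_rot; apply: allowed_rot.
- by exists y; split=> //; do ?[exact: allowed_rot]; apply: allowed_swap;
  apply: allowed_rot; apply: allowed_rot; apply: allowed_rev.
(* Either a difference of two sides exceeds [M] and bounds the diagonal from below, or none does. *)
have [[? [? ?]]|[[? [? ?]]|[[? [? ?]]|[[? [? ?]]|[? [? [? ?]]]]]]] :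
   (M + c < b /\ a <= e + (b - c) /\ e <= a + (b - c)) \/
   (M + b < c /\ a <= e + (c - b) /\ e <= a + (c - b)) \/
   (M + e < a /\ b <= c + (a - e) /\ c <= b + (a - e)) \/
   (M + a < e /\ b <= c + (e - a) /\ c <= b + (e - a)) \/
   (b <= c + M /\ c <= b + M /\ a <= e + M /\ e <= a + M) by lia.
- by left; exists (b - c);
    have [] := @diagonal_minus _ a b c e x (b - c) P ad bd cd ed xd abx xce; try lia;
      split=> //; lia.
- by right; left; exists (c - b);
    have [] := @diagonal_minus _ e c b a x (c - b) P ed cd bd ad xd ecx xba; try lia;
      split=> //; lia.
- by right; right; left; exists (a - e);
    have [] := @diagonal_minus _ b a e c x (a - e) P bd ad ed cd xd bax xec; try lia;
      split=> //; lia.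
- by right; right; right; exists (e - a);
    have [] := @diagonal_minus _ c e a b x (e - a) P cd ed ad bd xd cex xab; try lia;
      split=> //; lia.
(* Now either a sum of two sides or the perimeter bound [C] pushes the diagonal below [M], or [M]
   itself fits. *)
have [[? [? ?]]|[[? [? ?]]|[[? [? ?]]|[[? [? ?]]|[? [? [? ?]]]]]]] :
   (b + c < M /\ b + c <= a + e /\ a + e + b + c < C) \/
   (a + e < M /\ a + e <= b + c /\ b + c + a + e < C) \/
   (C <= M + b + c /\ a + e <= b + c /\ C <= a + e + b + c + 1) \/
   (C <= M + a + e /\ b + c <= a + e /\ C <= b + c + a + e + 1) \/
   (M <= b + c /\ M <= a + e /\ M + b + c < C /\ M + a + e < C) by lia.
- by left; exists (b + c);
    have [] := @diagonal_plus _ a b c e x (b + c) P ad bd cd ed xd abx xce; try lia;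
      split=> //; lia.
- by right; right; left; exists (a + e);
    have [] := @diagonal_plus _ b a e c x (a + e) P bd ad ed cd xd bax xec; try lia;
      split=> //; lia.
- have ? : 2 * d + 2 <= C by case: P; lia.
  by left; exists (C - 1 - b - c);
    have [] := @diagonal_C _ a b c e x (C - 1 - b - c) P ad bd cd ed xd abx xce;
      try lia; split=> //; lia.
- have ? : 2 * d + 2 <= C by case: P; lia.
  by right; right; left; exists (C - 1 - a - e);
    have [] := @diagonal_C _ b a e c x (C - 1 - a - e) P bd ad ed cd xd bax xec;
      try lia; split=> //; lia.
left; exists M; split=> //; first exact: (allowed_magic P).
by apply: allowed_rev; apply: allowed_rot; apply: (allowed_magic P).
Qed.

(* If the completion algorithm labels a pair by [a], then [c] can be the
   distance of that pair in a member of the class extending the given edges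
   only if [poss cIII a c]: [c] is at least as far from [M] as [a] on the same
   side, and a change of parity is limited by [K1] or [K2].  The exception is
   the fork (d, d) of case (II) with C' > C + 1, which forces only parity. *)
Definition poss (cIII : bool) (a c : nat) : Prop :=
  (a < M /\
    ((c <= a /\ exists h, a + c = 2 * h \/
        a + c = 2 * h + 1 /\ (K1 <= h \/ cIII /\ C <= a + 1 + 2 * d)) \/
     (~~ cIII /\ c1.+1 < c0 /\ a.+1 = M /\ exists h, a + c = 2 * h))) \/
  (a = M /\ c = M) \/
  (M < a /\ a <= c /\ exists h, a + c = 2 * h \/ a + c = 2 * h + 1 /\ h < K2).

(* The label [a] closes the path [x], [y]: away from [M] it is the extreme value
   permitted by the triangle inequality or by the perimeter bound [C - 1]. *)
Definition fork (a x y : nat) : Prop :=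
  (a < M /\ (x + y = a \/ x + y + a + 1 = C)) \/
  (M < a /\ (x = y + a \/ y = x + a)).

(* A pair finally labelled [a] carries a label from stage [T] on: [T = 0] for
   given edges, [T] past the last stage for pairs filled with [M]. *)
Definition dated (cIII : bool) (a T c : nat) : Prop :=
  (T = 0 /\ c = a) \/
  (poss cIII a c /\ (a < M /\ T = 2 * a \/ M < a /\ T = 2 * (d - a) + 1)) \/
  (a = M /\ T = 2 * d + 2).

(* Labels are treated in the order d, 1, d - 1, 2, ...: [x < M] at time
   [2 x - 1] and [x > M] at time [2 (d - x)]. *)
Definition unforced (Ta Tb Tc b c : nat) : Prop :=
  forall x k, 0 < x <= d -> (x < M /\ k.+1 = 2 * x \/ M < x /\ k = 2 * (d - x)) ->
    Tb <= k -> Tc <= k -> k.+1 < Ta -> ~ fork x b c.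

(** * Distances compatible with a label forced by a fork *)

Lemma poss_fork_plus cIII a x y x' y' c :
  0 < x -> 0 < y ->
  poss cIII x x' -> poss cIII y y' ->
  allowed x' y' c ->
  a < M -> x + y = a ->
  poss cIII a c.
Proof.
move=> ? ? X Y [? A] ? ?.
case: X => [[_ [[? [h Hh]]|]]|]; [|lia|lia].
case: Y => [[_ [[? [i Hi]]|]]|]; [|lia|lia].
left; split=> //; left; split; [lia|case: (halfP (a + c))=> k [Hk|Hk];
  exists k; [by left|right; split=> //]].
case: A => g Hg.
case: cIII Hh Hi=> ? ?; lia.
Qed.

(** [d <= 2 * M] puts [y] below [M] and [x] above it, so [x'] is at least [x], [y'] at most [y], and
    [c] at least [a]. The exceptional branch of [poss] would need [y = M - 1], which makes [x]
    exceed [d]. *)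
Lemma poss_fork_minus cIII a x y x' y' c :
  magic cIII ->
  0 < x <= d -> 0 < y <= d -> x' <= d -> y' <= d -> c <= d -> 0 < a <= d ->
  poss cIII x x' -> poss cIII y y' ->
  allowed x' y' c ->
  M < a -> x = y + a ->
  poss cIII a c.
Proof.
move=> P ? ? ? ? ? ? X Y [? A] Ma xya.
have Mx : M < x by lia. have yM : y < M by case: P; lia.
case: X => [|[]]; [lia|lia|]=> -[_ [xx' [h Hh]]].
have y'y : y' <= y.
  case: Y => [[_ [[]//|]]|]; last lia.
  by case: cIII P => //; rewrite /magic; lia.
right; right; split=> //; split; [lia|]; case: (halfP (a + c))=> k Hk; exists k.
case: Hk=> Hk; [by left|right; split=> //].
case: A => g Hg.
case: Y => [[_ [[_ [i Hi]]|]]|]; [|by case: cIII P => //; rewrite /magic; lia|lia].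
case: P=> [? [? [? P]]]; case: Hi=> [|[? [|[? ?]]]]; [lia|..]; destruct cIII=> //; lia.
Qed.

(** Both legs lie above [M], so their true distances are no smaller and the perimeter bound limits
    [c]. If the bounds for the two parities are more than one apart, case (III) excludes this fork,
    and case (II) determines only the parity of [c]. *)
Lemma poss_fork_C cIII a x y x' y' c :
  magic cIII ->
  0 < x <= d -> 0 < y <= d -> x' <= d -> y' <= d -> c <= d -> 0 < a <= d ->
  poss cIII x x' -> poss cIII y y' ->
  allowed x' y' c ->
  a < M -> x + y + a + 1 = C ->
  poss cIII a c.
Proof.
move=> P ? ? ? ? ? ? X Y A ? ?.
left; split=> //.
have ? : M < x by case: P; lia. have ? : M < y by case: P; lia.
case: X => [|[]]; [lia|lia|]=> -[_ [xx' [h Hh]]].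
case: Y => [|[]]; [lia|lia|]=> -[_ [yy' [i Hi]]].
have [[X1 Y1]|N] : (cIII = false /\ c1.+1 < c0) \/ (cIII = false -> c0 <= c1.+1).
- case: cIII {P} => /=; lia.
- right; rewrite X1; split=> //; split=> //; subst cIII.
  by clear Hh Hi; case: (halfP (a + c))=> k Hk; split; [|exists k]; prep; lia.
left; split; [|case: (halfP (a + c))=> k [Hk|Hk];
  exists k; [by left|right; split=> //]].
  by clear Hh Hi; destruct cIII; [|have {N} := N erefl => ?]; prep; lia.
destruct cIII; [by right; split=> //; lia|left; have {N} := N erefl => ?; prep; lia].
Qed.

(** * Triangles of the completed labelling *)

Lemma dated_time cIII a T a' :
  dated cIII a T a' ->
  (a < M -> T <= 2 * a) /\ (M < a -> T <= 2 * (d - a) + 1) /\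
  ((T = 0 /\ a' = a) \/ (a < M /\ T = 2 * a \/ M < a /\ T = 2 * (d - a) + 1) \/
    (a = M /\ T = 2 * d + 2)).
Proof. by case=> [|[[_]|]]; lia. Qed.

(** Both [b] and [c] are dated before the stage that treats [b + c], so a later third label would
    contradict [unforced]. The next two lemmas are the analogues for the other forks. *)
Lemma time_bound_plus cIII b c b' c' Ta Tb Tc :
  magic cIII -> 0 < b <= d -> 0 < c <= d ->
  dated cIII b Tb b' ->
  dated cIII c Tc c' ->
  unforced Ta Tb Tc b c ->
  b + c < M -> Ta <= 2 * (b + c).
Proof.
move=> [? [? [? _]]] Hb Hc /dated_time [? [_ _]] /dated_time [? [_ _]] U N.
case: leqP=> // T; exfalso; apply: (U (b + c) (2 * (b + c)).-1); try lia.
by left; split=> //; left.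
Qed.

Lemma time_bound_minus cIII a c a' c' Ta Tb Tc :
  magic cIII -> 0 < a <= d -> 0 < c <= d ->
  dated cIII a Ta a' ->
  dated cIII c Tc c' ->
  unforced Tb Ta Tc a c ->
  M + c < a -> Tb <= 2 * (d - (a - c)) + 1.
Proof.
move=> [? [? [? _]]] Hb Hc /dated_time [_ [? _]] /dated_time [? [_ _]] U N.
case: leqP=> // T; exfalso; apply: (U (a - c) (2 * (d - (a - c)))); try lia.
by right; split; [lia|left; lia].
Qed.

Lemma time_bound_C cIII b c b' c' Ta Tb Tc :
  magic cIII -> 0 < b <= d -> 0 < c <= d ->
  dated cIII b Tb b' ->
  dated cIII c Tc c' ->
  unforced Ta Tb Tc b c ->
  C <= M + b + c -> Ta <= 2 * (C - 1 - b - c).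
Proof.
move=> [? [? [? _]]] Hb Hc /dated_time [_ [? _]] /dated_time [_ [? _]] U N.
case: leqP=> // T; exfalso; apply: (U (C - 1 - b - c) (2 * (C - 1 - b - c)).-1); try lia.
by left; split; [lia|right; lia].
Qed.

(** Suppose [b + c < a]. By the time bounds, [a'] is at least [a], while [b'] and [c'] are at most
    [b] and [c] except for the fork [(d, d)] of case (II). So [a' <= b' + c'] fails; in the
    exceptional situation parity and the bounds of case (II) give the contradiction. *)
Lemma completed_metric cIII a b c a' b' c' Ta Tb Tc :
  magic cIII ->
  0 < a <= d -> 0 < b <= d -> 0 < c <= d ->
  dated cIII a Ta a' ->
  dated cIII b Tb b' ->
  dated cIII c Tc c' ->
  unforced Ta Tb Tc b c -> unforced Tb Ta Tc a c -> unforced Tc Ta Tb a b ->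
  allowed a' b' c' ->
  a <= b + c.
Proof.
move=> P Ha Hb Hc Da Db Dc Ua Ub Uc T.
case: leqP=> // N; exfalso.
have {}Ua := time_bound_plus P Hb Hc Db Dc Ua.
have {}Ub := time_bound_minus P Ha Hc Da Dc Ub.
have {}Uc := time_bound_minus P Ha Hb Da Db Uc.
have [aa' Qa] : a <= a' /\ exists h, a + a' = 2 * h \/ a + a' < 2 * K2.
  have {Ub Uc Db Dc} := dated_time Da; case: Da => [[? ->]|[[]|]].
  - by split=> //; exists a; lia.
  - case=> [|[|[? [? [h Hh]]]]]; case: P => ? [? _]; try lia.
    by split=> //; exists h; lia.
  by case: P => ? [? _]; lia.
have bb' : (b' <= b /\ exists h, b + b' = 2 * h \/ 2 * K1 < b + b' \/ cIII) \/
  (~~ cIII /\ c1.+1 < c0 /\ b.+1 = M /\ Tb = 2 * b /\ exists h, b + b' = 2 * h).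
  have {Ua Uc Da Dc} := dated_time Db; case: Db => [[? ->]|[[]|]]; [by left;
    split=> //; exists b; lia| |lia].
  case=> [[_ [[? [h Hh]]|[? [? [? ?]]]]]|]; [|by right; do !split=> //; lia|lia].
  by left; split=> //; exists h; case: Hh => [|[? [|[]]]]; lia.
have cc' : (c' <= c /\ exists h, c + c' = 2 * h \/ 2 * K1 < c + c' \/ cIII) \/
  (~~ cIII /\ c1.+1 < c0 /\ c.+1 = M /\ Tc = 2 * c /\ exists h, c + c' = 2 * h).
  have {Ua Ub Da Db} := dated_time Dc; case: Dc => [[? ->]|[[]|]]; [by left;
    split=> //; exists c; lia| |lia].
  case=> [[_ [[? [h Hh]]|[? [? [? ?]]]]]|]; [|by right; do !split=> //; lia|lia].
  by left; split=> //; exists h; case: Hh => [|[? [|[]]]]; lia.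
case: T => ? [h T].
case: bb' cc' => [[? [g bg]]|[bC [? [? [? [g bg]]]]]]
  [[? [i ci]]|[cC [? [? [? [i ci]]]]]]; first lia.
all: case: Qa => j Qa; destruct cIII => //; case: P => [? [? [? ?]]]; lia.
Qed.

(** Below [K1] the parity cannot change: [K1 <= h] is impossible for [a' <= a], and
    [C <= a + 1 + 2 * d] contradicts [C > 2 * d + K1]. *)
Lemma dated_small cIII a T a' :
  magic cIII -> dated cIII a T a' -> a < K1 ->
  (exists h, a + a' = 2 * h) /\
  (a' <= a \/ cIII = false /\ c1.+1 < c0 /\ a.+1 = M).
Proof.
move=> P D aK; have aM : a < M by case: P; lia.
case: D => [[_ ->]|[[[[_ [[? [h Hh]]|[? [? [? ?]]]]]|]]|]]; try lia.
- by split; [exists a; lia|left].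
- split; [exists h|by left]. case: Hh=> // [[? [|[cI ?]]]]; first by lia.
  by rewrite cI in P; case: P; lia.
by split=> //; right; do !split=> //; apply/negbTE.
Qed.

(** Each side is at most [h]. If [h < K1], all parities are kept and the underlying triangle is odd;
    outside the exceptional fork its perimeter is no larger, against the bound [K1]. The constraints
    of case (II) exclude the exceptional fork. *)
Lemma completed_K1 cIII a b c a' b' c' Ta Tb Tc h :
  magic cIII ->
  0 < a <= d -> 0 < b <= d -> 0 < c <= d ->
  dated cIII a Ta a' ->
  dated cIII b Tb b' ->
  dated cIII c Tc c' ->
  allowed a' b' c' ->
  a <= b + c -> b <= a + c -> c <= a + b -> a + b + c = 2 * h + 1 -> K1 <= h.
Proof.
move=> P Ha Hb Hc Da Db Dc T ab bc ac E; case: leqP => // N; exfalso.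
have [|[i Hi] Ia] := dated_small P Da; first lia.
have [|[j Hj] Ib] := dated_small P Db; first lia.
have [|[k Hk] Ic] := dated_small P Dc; first lia.
case: T=> ? [g [?|?]]; first lia.
case: Ia => [?|[cI [? ?]]]. case: Ib => [?|[cI [? ?]]]. case: Ic => [?|[cI [? ?]]]. lia.
all: rewrite cI in P; case: P=> [? [? [? ?]]]; lia.
Qed.

(** A perimeter of at least [C] forces [b] and [c] above [M], and by the time bound [a] is above [M]
    or a given edge, so no side of the underlying triangle is shorter. Parity matters only if the
    bounds for even and odd perimeters are more than one apart; then [K2 <= a] keeps all
    parities. *)
Lemma completed_C cIII a b c a' b' c' Ta Tb Tc h :
  magic cIII ->
  0 < a <= d -> 0 < b <= d -> 0 < c <= d ->
  dated cIII a Ta a' ->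
  dated cIII b Tb b' ->
  dated cIII c Tc c' ->
  unforced Ta Tb Tc b c ->
  allowed a' b' c' ->
  a <= b -> b <= c -> c <= a + b ->
  (a + b + c = 2 * h -> h < c0) /\ (a + b + c = 2 * h + 1 -> h < c1).
Proof.
move=> P Ha Hb Hc Da Db Dc Ua T ab bc ac.
suff : ~ ((a + b + c = 2 * h /\ c0 <= h) \/ (a + b + c = 2 * h + 1 /\ c1 <= h)) by lia.
move=> N.
have NC : C <= a + b + c by case: P; lia.
have {}Ua := time_bound_C P Hb Hc Db Dc Ua.
have [bM cM] : M < b /\ M < c by clear - P NC Ha Hb Hc ab bc; case: P => ? [? ?]; lia.
have {Dc} [Cc [k Hk]] : c <= c' /\ exists h, c + c' = 2 * h \/ c + c' < 2 * K2.
  clear - Dc cM; case: Dc => [[_ ->]|[[[[? _]|[[? _]|[_ [? [g Hg]]]]] _]|[? _]]];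
    try (by exfalso; lia).
    by split=> //; exists c; lia.
  by split=> //; exists g; lia.
have {Db} [Bb [j Hj]] : b <= b' /\ exists h, b + b' = 2 * h \/ b + b' < 2 * K2.
  clear - Db bM; case: Db => [[_ ->]|[[[[? _]|[[? _]|[_ [? [g Hg]]]]] _]|[? _]]];
    try (by exfalso; lia).
    by split=> //; exists b; lia.
  by split=> //; exists g; lia.
have {Ua Da} [Aa [i Hi]] : a <= a' /\ exists h, a + a' = 2 * h \/ a + a' < 2 * K2.
  have [_ [_ ta]] := dated_time Da.
  have aP : M < a \/ Ta = 0.
    by clear - Ua ta P NC Ha Hb Hc; case: P=> [? [? [? _]]]; lia.
  clear - Da aP Ha; case: Da => [[_ ->]|[[[[? _]|[[? _]|[_ [? [g Hg]]]]] [?|?]]|[? ?]]];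
    try (by exfalso; lia).
  - by split=> //; exists a; lia.
  by split=> //; exists g; lia.
case: T=> _ [g Hg].
have [E|Ka] : (c0 = c1 \/ c0 = c1.+1) \/ K2 <= a.
- by clear - P NC Ha Hb Hc; destruct cIII; case: P => [? [? [? ?]]]; lia.
- by clear - E N Hg Aa Bb Cc; lia.
have [Ei [Ej Ek]] : a + a' = 2 * i /\ b + b' = 2 * j /\ c + c' = 2 * k.
  by clear - Ka ab bc Hi Hj Hk Aa Bb Cc; lia.
by clear - Ei Ej Ek Aa Bb Cc N Hg; lia.
Qed.

(** If the bound fails, [b] and [c] exceed [K2], so [b'] and [c'] are at least as large and of the
    same parity. Outside the exceptional fork [a'] is at most [a], again of the same parity, so the
    bound already fails in the underlying triangle. *)
Lemma completed_K2 cIII a b c a' b' c' Ta Tb Tc h :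
  magic cIII ->
  0 < a <= d -> 0 < b <= d -> 0 < c <= d ->
  dated cIII a Ta a' ->
  dated cIII b Tb b' ->
  dated cIII c Tc c' ->
  allowed a' b' c' ->
  a + b + c = 2 * h + 1 -> h < c1 ->
  b <= c -> c <= a + b -> h < K2 + a.
Proof.
move=> P Ha Hb Hc Da Db Dc T ab bc ac Q.
case: ltnP => // N; exfalso.
have [bM cM] : M < b /\ M < c by clear - P Ha Hb Hc N ab bc ac Q; case: P => ? [? ?]; lia.
have [cc' [k Hk]] : c <= c' /\ exists h, c + c' = 2 * h \/ c + c' < 2 * K2.
  case: Dc => [[_ ->]|[[[[? _]|[[? _]|[_ [? [g Hg]]]]] _]|[? _]]]; try (by exfalso;
    lia); first by split=> //; exists c; lia.
  by split=> //; exists g; lia.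
have [bb' [j Hj]] : b <= b' /\ exists h, b + b' = 2 * h \/ b + b' < 2 * K2.
  case: Db => [[_ ->]|[[[[? _]|[[? _]|[_ [? [g Hg]]]]] _]|[? _]]]; try (by exfalso;
    lia); first by split=> //; exists b; lia.
  by split=> //; exists g; lia.
have aP : a < M \/ Ta = 0.
  case: (dated_time Da) => _ [_ ta].
  suff : ~ (M <= a /\ Ta > 0) by lia.
  by destruct cIII; case: P => [? [? [? ?]]]; lia.
have {Da} [[g Hg] aa'] : (exists h, a + a' = 2 * h) /\
  (a' <= a \/ cIII = false /\ c1.+1 < c0 /\ a.+1 = M).
  case: Da => [[_ ->]|[[[[_ [[a'a [g Hg]]|[? [? [? ?]]]]]|[[? _]|[? _]]] ?]|[? ?]]];
    try (by exfalso; lia).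
  - by split; [exists a; lia|left].
  - split; [exists g|by left]; move: Hg; clear - P N bc Ha Hb Hc ab a'a.
    by destruct cIII; case: P => [? [? [? ?]]]; lia.
  by split=> //; right; do !split=> //; apply/negbTE.
case: T=> ? [i [?|?]]; first by case: P => [? [? _]]; lia.
case: aa' => [?|[cI [? ?]]]; first by case: P => [? [? _]]; lia.
by rewrite cI in P; case: P => [? [? ?]]; lia.
Qed.

Lemma poss_refl cIII a : poss cIII a a.
Proof.
case: (ltngtP a M) => aM.
- by left; split=> //; left; split=> //; exists a; left; lia.
- by right; right; split=> //; split=> //; exists a; left; lia.
by right; left.
Qed.

Lemma poss_fork cIII a x y x' y' c : magic cIII ->
  0 < x <= d -> 0 < y <= d -> x' <= d -> y' <= d -> c <= d -> 0 < a <= d ->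
  poss cIII x x' -> poss cIII y y' -> allowed x' y' c ->
  fork a x y -> poss cIII a c.
Proof.
move=> P ? ? ? ? ? ? X Y A [[aM [E|E]]|[aM [E|E]]].
- by apply: (poss_fork_plus _ _ X Y A) => //; lia.
- exact: (poss_fork_C P _ _ _ _ _ _ X Y A).
- exact: (poss_fork_minus P _ _ _ _ _ _ X Y A).
exact: (poss_fork_minus P _ _ _ _ _ _ Y X (allowed_swap A)).
Qed.

Lemma fork_sym a x y : fork a x y -> fork a y x.
Proof. by rewrite /fork; lia. Qed.

Lemma unforced_sym Ta Tb Tc b c : unforced Ta Tb Tc b c -> unforced Ta Tc Tb c b.
Proof. by move=> U x k ? ? ? ? ? /fork_sym; apply: (U x k). Qed.

Lemma completed_allowed_sorted cIII a b c a' b' c' Ta Tb Tc : magic cIII ->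
  0 < a <= d -> 0 < b <= d -> 0 < c <= d ->
  dated cIII a Ta a' -> dated cIII b Tb b' -> dated cIII c Tc c' ->
  unforced Ta Tb Tc b c -> unforced Tb Ta Tc a c -> unforced Tc Ta Tb a b ->
  allowed a' b' c' -> a <= b -> b <= c -> allowed a b c.
Proof.
move=> P Ha Hb Hc Da Db Dc Ua Ub Uc T ab bc.
have cab := completed_metric P Hc Ha Hb Dc Da Db Uc (unforced_sym Ua) (unforced_sym Ub)
              (allowed_rot (allowed_rot T)).
split; first lia.
have [h Hh] := halfP (a + b + c); exists h.
have [E O] := completed_C h P Ha Hb Hc Da Db Dc Ua T ab bc cab.
case: Hh => Hh; [left; split=> //; exact: E|right; split=> //].
have k1 : K1 <= h by apply: (completed_K1 P Ha Hb Hc Da Db Dc T); lia.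
have k2 := completed_K2 P Ha Hb Hc Da Db Dc T Hh (O Hh) bc cab.
by rewrite k1 (O Hh); lia.
Qed.

Lemma completed_allowed cIII a b c a' b' c' Ta Tb Tc : magic cIII ->
  0 < a <= d -> 0 < b <= d -> 0 < c <= d ->
  dated cIII a Ta a' -> dated cIII b Tb b' -> dated cIII c Tc c' ->
  unforced Ta Tb Tc b c -> unforced Tb Ta Tc a c -> unforced Tc Ta Tb a b ->
  allowed a' b' c' -> allowed a b c.
Proof.
move=> P Ha Hb Hc Da Db Dc Ua Ub Uc T.
have Ua' := unforced_sym Ua; have Ub' := unforced_sym Ub.
have Uc' := unforced_sym Uc; have S := completed_allowed_sorted P.
have T1 := allowed_rot T; have T2 := allowed_rot T1.
have [ab|ba] := leqP a b; have [bc|cb] := leqP b c; have [ac|ca] := leqP a c; try lia.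
- exact: (S _ _ _ _ _ _ _ _ _ Ha Hb Hc Da Db Dc Ua Ub Uc T).
- apply: allowed_swap; apply: allowed_rot; apply: allowed_rot.
  by apply: (S _ _ _ _ _ _ _ _ _ Ha Hc Hb Da Dc Db Ua' Uc Ub (allowed_swap T2)); lia.
- apply: allowed_rot.
  by apply: (S _ _ _ _ _ _ _ _ _ Hc Ha Hb Dc Da Db Uc Ua' Ub' T2); lia.
- apply: allowed_swap.
  by apply: (S _ _ _ _ _ _ _ _ _ Hb Ha Hc Db Da Dc Ub Ua Uc' (allowed_swap T)); lia.
- apply: allowed_rot; apply: allowed_rot.
  by apply: (S _ _ _ _ _ _ _ _ _ Hb Hc Ha Db Dc Da Ub' Uc' Ua T1); lia.
apply: allowed_rev.
by apply: (S _ _ _ _ _ _ _ _ _ Hc Hb Ha Dc Db Da Uc' Ub' Ua' (allowed_rev T)); lia.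
Qed.

End MagicParameter.

(** * Choice of the magic distance *)

Lemma magic_exists d K1 K2 C0 C1 : primitive_admissible d K1 K2 C0 C1 ->
  exists c0 c1 C M cIII,
    [/\ C0 = 2 * c0, C1 = 2 * c1 + 1 & magic d K1 K2 c0 c1 C M cIII].
Proof.
move=> [d3 [[k1 k12 k2] [b0 [b1 [e0 [e1 [g0 [g1 A]]]]]]]].
have [c0 E0] : exists c0, C0 = 2 * c0 by exists C0./2; lia.
have [c1 E1] : exists c1, C1 = 2 * c1 + 1 by exists C1./2; lia.
subst C0 C1; exists c0, c1, (minn (2 * c0) (2 * c1 + 1)).
set C := minn _ _ in A *.
have EC : (C = 2 * c0 /\ c0 <= c1 \/ C = 2 * c1 + 1 /\ c1 < c0) by rewrite /C; lia.
have EC' : maxn (2 * c0) (2 * c1 + 1) = 2 * c0 + 2 * c1 + 1 - C by rewrite /C; lia.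
rewrite EC' in A; clearbody C; clear EC'.
(* [maxn K1 D] is the least value with [K1 <= M] and [d <= 2 * M]; only the borderline
   [K1 + 2 * K2 = 2 * d - 1] of case (III) asks for [K1 < M] instead. *)
have [D [HD0 HD1]] : exists D, d <= 2 * D /\ 2 * D <= d + 1 by exists (uphalf d); lia.
case: A => [[A1 A2 A3 A4 A5]|[A1 A2 A3 A4 A5]].
- exists (maxn K1 D), false; split=> //; rewrite /magic.
  case: A5 => [|[? ? ?]]; lia.
have [B|B] : (K1 + 2 * K2 = 2 * d - 1) \/ (K1 + 2 * K2 <> 2 * d - 1) by lia.
- exists (maxn K1.+1 D), true; split=> //; rewrite /magic; lia.
exists (maxn K1 D), true; split=> //; rewrite /magic; lia.
Qed.

(** Degenerate triples are included: their perimeter is twice a distance, hence below [2 * c0]. *)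
Lemma allowed_classA d K1 K2 c0 c1 (M : intMetric) :
  d < c0 -> in_classA d K1 K2 (2 * c0) (2 * c1 + 1) M <->
  forall x y z : M, dist x y <= d /\
    allowed K1 K2 c0 c1 (dist x y) (dist y z) (dist x z).
Proof.
move=> dc; split=> [[B T] x y z|H].
- have D (u v : M) : dist u v <= d.
    have [->|uv] := eqVneq u v; last by have /andP[] := B _ _ uv.
    by rewrite (proj2 (dist_eq0 v v) erefl).
  split=> //.
  have Z (u : M) : dist u u = 0 by apply/dist_eq0.
  have [->|xy] := eqVneq x y.
    by rewrite Z; split; [lia|exists (dist y z); have := D y z; lia].
  have [<-|yz] := eqVneq y z.
    by rewrite Z; split; [lia|exists (dist x y); have := D x y; lia].
  have [<-|xz] := eqVneq x z.
    by rewrite Z (dist_sym y x); split; [lia|exists (dist x y); have := D x y; lia].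
  have /= [To Te] := T _ _ _ xy yz xz.
  have t1 := dist_triangle x y z; have t2 := dist_triangle y x z.
  have t3 := dist_triangle x z y.
  rewrite (dist_sym y x) in t2; rewrite (dist_sym z y) in t3.
  split; first lia.
  have [h Hh] := halfP (dist x y + dist y z + dist x z); exists h.
  case: (boolP (odd (dist x y + dist y z + dist x z))).
    by move=> /[dup]/To[? ? ?] ?; lia.
  by move=> /[dup]/Te ? ?; lia.
split=> [x y xy|x y z xy yz xz] /=.
  have [-> _] := H x y y; rewrite andbT lt0n; apply/eqP => /dist_eq0.
  exact/eqP.
have [_ [? [h Hh]]] := H x y z.
by split=> o; [split|]; lia.
Qed.

(** * Hales-Jewett and Ramsey *)

(* Words are sequences; a line is a word over [option T] containing the moving
   letter [None]. *)
Definition subst (T : Type) (L : seq (option T)) (x : T) : seq T :=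
  [seq odflt x o | o <- L].

Definition mono_line (T K : eqType) (chi : seq T -> K) n L :=
  [/\ size L = n, None \in L & forall x y, chi (subst L x) = chi (subst L y)].

Definition hales_jewett (T : finType) : Prop :=
  forall K : finType, exists n, forall chi : seq T -> K,
  exists L, mono_line chi n L.

Lemma subst_cat T (L1 L2 : seq (option T)) x :
  subst (L1 ++ L2) x = subst L1 x ++ subst L2 x.
Proof. exact: map_cat. Qed.

Lemma subst_const T (w : seq T) x : subst (map Some w) x = w.
Proof. by rewrite /subst -map_comp map_id. Qed.

Lemma subst_lift T (L : seq (option T)) x :
  subst (map (omap Some) L) (Some x) = map Some (subst L x).
Proof. by rewrite /subst -!map_comp; apply: eq_map => -[]. Qed.

Section ColourFocusing.

Variables (T : finType) (x0 : T) (K : finType).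
Hypothesis HJ : hales_jewett T.

(** Colour focusing: the lines in [Ls] meet in [f] at the new letter [None], and on the old letters
    each has a colour of its own. *)
Definition focused (chi : seq (option T) -> K) n f Ls :=
  [/\ size f = n,
      uniq [seq chi (subst L (Some x0)) | L <- Ls] &
      forall L, L \in Ls -> [/\ size L = n, None \in L, subst L None = f &
        forall x, chi (subst L (Some x)) = chi (subst L (Some x0))]].

(** Induction on the number of lines. Hales-Jewett for the old letters, where the colours are
    colourings of all suffixes, gives a first block [L0] on which changing the old letter has no
    effect; the second block comes from the induction. *)
Lemma colour_focusing s : exists n, forall chi : seq (option T) -> K,
  (exists L, mono_line chi n L) \/
  (exists f Ls, size Ls = s /\ focused chi n f Ls).
Proof.
elim: s => [|s [n' IH]].
  by exists 0 => chi; right; exists [::], [::].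
have [n Hn] := HJ {ffun n'.-tuple (option T) -> K}.
exists (n + n') => chi.
have [L0 [sL0 nL0 mL0]] :=
  Hn (fun w => [ffun u : n'.-tuple (option T) => chi (map Some w ++ u)]).
pose pre x := map Some (subst L0 x).
have preE x y u : size u = n' -> chi (pre x ++ u) = chi (pre y ++ u).
  move=> su; have /ffunP/(_ (tcast su (in_tuple u))) := mL0 x y.
  by rewrite !ffunE !val_tcast.
have spre x : size (pre x) = n by rewrite !size_map.
case: (IH (fun u => chi (pre x0 ++ u))) => [[L [sL nL mL]]|[f [Ls [sLs [sf uLs hLs]]]]].
  left; exists (map Some (pre x0) ++ L); split.
  - by rewrite size_cat size_map spre sL.
  - by rewrite mem_cat nL orbT.
  by move=> x y; rewrite !subst_cat !subst_const.
(* If the focus has the colour of some line, that line stays monochromatic with the new letter;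
   otherwise [L1] followed by the constant focus has a new colour. *)
have [/mapP[L LL fE]|fN] := boolP (chi (pre x0 ++ f) \in
    [seq chi (pre x0 ++ subst L (Some x0)) | L <- Ls]).
  have [sL nL fL mL] := hLs L LL; left; exists (map Some (pre x0) ++ L); split.
  - by rewrite size_cat size_map spre sL.
  - by rewrite mem_cat nL orbT.
  suff E z : chi (subst (map Some (pre x0) ++ L) z) = chi (pre x0 ++ f).
    by move=> x y; rewrite !E.
  by rewrite subst_cat subst_const; case: z => [z|]; rewrite ?fL // mL -fE.
right; pose L1 := map (omap Some) L0.
have nL1 : None \in L1 by apply/mapP; exists None.
have sL1 : size L1 = n by rewrite size_map.
have L1E x : subst L1 (Some x) = pre x by exact: subst_lift.
exists (subst L1 None ++ f), ((L1 ++ map Some f) :: [seq L1 ++ L | L <- Ls]).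
rewrite /= size_map sLs; split=> //.
have colE L x : L \in Ls ->
  chi (subst (L1 ++ L) (Some x)) = chi (pre x0 ++ subst L (Some x0)).
  move=> LL; have [sL _ _ mL] := hLs L LL.
  by rewrite subst_cat L1E (preE x x0) ?mL // size_map.
split; first by rewrite size_cat size_map sL1 sf.
- rewrite /= subst_cat subst_const L1E -map_comp.
  have -> : [seq ((fun L => chi (subst L (Some x0))) \o cat L1) L | L <- Ls] =
            [seq chi (pre x0 ++ subst L (Some x0)) | L <- Ls].
    by apply/eq_in_map => L LL /=; rewrite colE.
  by rewrite fN.
move=> L; rewrite inE => /orP[/eqP->|/mapP[L' LL' ->]].
  split; first by rewrite size_cat !size_map sL0 sf.
  - by rewrite mem_cat nL1.
  - by rewrite subst_cat subst_const.
  by move=> x; rewrite !subst_cat !subst_const !L1E (preE x x0).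
have [sL nL fL mL] := hLs L' LL'; split.
- by rewrite size_cat sL1 sL.
- by rewrite mem_cat nL1.
- by rewrite subst_cat fL.
by move=> x; rewrite !colE.
Qed.

End ColourFocusing.

Lemma hales_jewett_option (T : finType) (x0 : T) :
  hales_jewett T -> hales_jewett (option T).
Proof.
move=> HJ K; have [n Hn] := colour_focusing x0 K HJ #|K|.+1.
exists n => chi; case: (Hn chi) => // -[f [Ls [sLs [_ uLs _]]]].
have := max_card (mem [seq chi (subst L (Some x0)) | L <- Ls]).
by rewrite (card_uniqP uLs) size_map sLs ltnn.
Qed.

Lemma hales_jewett_subsingleton (T : finType) :
  (forall x y : T, x = y) -> hales_jewett T.
Proof.
move=> TE K; exists 1 => chi; exists [:: None]; split=> // x y.
by rewrite (TE x y).
Qed.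

Lemma hales_jewett_surj (S T : finType) (f : S -> T) (g : T -> S) :
  cancel g f -> hales_jewett S -> hales_jewett T.
Proof.
move=> gK HJ K; have [n Hn] := HJ K; exists n => chi.
have [L [sL nL mL]] := Hn (chi \o map f).
have E x : subst (map (omap f) L) x = map f (subst L (g x)).
  by rewrite /subst -!map_comp; apply: eq_map => -[y|] //=; rewrite gK.
exists (map (omap f) L); split; rewrite ?size_map //.
  by apply/mapP; exists None.
by move=> x y; rewrite !E; apply: mL.
Qed.

Theorem hales_jewett_thm (T : finType) : hales_jewett T.
Proof.
move: {2}(#|T|) (erefl #|T|) => n; elim: n T => [|n IH] T cT.
  apply: hales_jewett_subsingleton => x.
  by move: (fintype0 x); rewrite cT.
(* Focusing needs an old letter, so alphabets with at most one letter are treated directly. *)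
case: n => [|n] in IH cT *.
  have /fintype1P[z zT] : #|T| == 1 by rewrite cT.
  by apply: hales_jewett_subsingleton => x y; rewrite (zT x) (zT y).
have HJ : hales_jewett (option 'I_n.+1).
  by apply: (hales_jewett_option ord0); apply: IH; rewrite card_ord.
have cO : #|{: option 'I_n.+1}| = #|T| by rewrite card_option card_ord cT.
apply: (@hales_jewett_surj _ T (fun o => enum_val (cast_ord cO (enum_rank o)))
  (fun x => enum_val (cast_ord (esym cO) (enum_rank x)))) HJ => x.
by rewrite enum_valK cast_ordKV enum_rankK.
Qed.

(** * Ramsey's theorem for subsequences *)

Fixpoint head_determined (T : eqType) (K : Type) (chi : seq T -> K) a s : Prop :=
  if s is x :: s' then
    (exists k, forall t, subseq t s' -> size t = a -> chi (x :: t) = k) /\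
    head_determined chi a s'
  else True.

(** Each element goes to the class of the colour that it determines as a head. *)
Lemma head_determined_split (T : eqType) (K : finType) (chi : seq T -> K) a s :
  head_determined chi a s ->
  exists g : K -> seq T, \sum_k size (g k) = size s /\
    forall k, subseq (g k) s /\
      forall t, subseq t (g k) -> size t = a.+1 -> chi t = k.
Proof.
elim: s => [_|x s IH /= [[k0 Hk0] /IH[g [gs gP]]]].
  exists (fun=> [::]); split; first by rewrite big1.
  by move=> k; split=> // t; rewrite subseq0 => /eqP->.
exists (fun k => if k == k0 then x :: g k else g k); split.
  rewrite (bigD1 k0) //= eqxx /= -gs [in RHS](bigD1 k0) //= addSn; congr (_ + _).+1.
  by apply: eq_bigr => k /negPf->.
move=> k; have [gk hk] := gP k; case: eqP => [kE|_]; last first.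
  by split=> //; exact: subseq_trans gk (subseq_cons _ _).
split; first by rewrite /= eqxx.
case=> [|y t] //=; case: eqP => [-> tg [ta]|_]; last exact: hk.
by rewrite kE; apply: Hk0 => //; apply: subseq_trans gk.
Qed.

Theorem ramsey_subseq (K : finType) a m : exists r,
  forall (T : eqType) (chi : seq T -> K) (S : seq T), r <= size S ->
  exists s, [/\ subseq s S, size s = m &
    forall t1 t2, subseq t1 s -> subseq t2 s -> size t1 = a -> size t2 = a ->
      chi t1 = chi t2].
Proof.
elim: a m => [|a IHa] m.
  exists m => T chi S mS; exists (take m S); rewrite take_subseq size_takel //.
  by split=> // t1 t2 _ _ /size0nil-> /size0nil->.
(* Making the tail homogeneous for one head after another leaves a sequence in which heads decide
   the colour. One element more than [#|K| * m] forces a colour class of size at least [m]. *)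
have [r Hr] : exists r, forall (T : eqType) (chi : seq T -> K) S, r <= size S ->
  exists s, [/\ subseq s S, size s = (#|K| * m).+1 & head_determined chi a s].
  elim: (#|K| * m).+1 => [|l [r IHl]]; first by exists 0 => T chi S _; exists [::];
    rewrite sub0seq.
  have [q Hq] := IHa r; exists q.+1 => T chi [//|x S] /= qS.
  have [s [sS sr sh]] := Hq T (fun t => chi (x :: t)) S qS.
  have rs : r <= size s by rewrite sr.
  have [u [us ul uh]] := IHl T chi s rs; exists (x :: u); rewrite /= eqxx ul; split=> //.
    exact: subseq_trans us sS.
  split=> //; exists (chi (x :: take a u)) => t tu ta.
  have au : a <= size u by rewrite -ta size_subseq.
  apply: sh => //; rewrite ?size_takel //.
    exact: subseq_trans tu us.
  exact: subseq_trans (take_subseq _ _) us.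
exists r => T chi S /(Hr T chi)[s [sS sl /head_determined_split[g [gs gP]]]].
have [k mk] : exists k, m <= size (g k).
  apply/existsP; apply: contraT; rewrite negb_exists => /forallP gm.
  have : \sum_k size (g k) <= \sum_(k : K) m.
    by apply: leq_sum => k _; rewrite ltnW // ltnNge gm.
  by rewrite gs sl sum_nat_const ltnn.
have [gks hk] := gP k; exists (take m (g k)); split.
- exact: subseq_trans (take_subseq _ _) (subseq_trans gks sS).
- by rewrite size_takel.
move=> t1 t2 h1 h2 z1 z2.
by rewrite (hk _ (subseq_trans h1 (take_subseq _ _)) z1)
           (hk _ (subseq_trans h2 (take_subseq _ _)) z2).
Qed.

Lemma undup_const (T : eqType) (l : T) s :
  l \in s -> all (pred1 l) s -> undup s = [:: l].
Proof.
elim: s => //= x s IH ls /andP[/eqP xl al]; rewrite {x}xl in ls *.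
have [lS|lS] := boolP (l \in s); first exact: IH.
by case: s lS al {IH ls} => //= y s; rewrite inE eq_sym => /norP[/negPf->].
Qed.

(** * Partite construction *)

(* Label [0] means that there is no edge. *)
Record picture (W : Type) := Picture {
  pvertex :> finType;
  plabel : pvertex -> pvertex -> nat;
  pproj : pvertex -> W
}.

Definition plabel_sym W (P : picture W) := forall x y : P, plabel x y = plabel y x.

Section PartiteStep.

Variables (A : finType) (dA : A -> A -> nat) (W : finType).
Variables (cw : W -> W -> nat -> Prop).
Hypothesis dA_sym : forall a b, dA a b = dA b a.
Hypothesis dA_eq0 : forall a b, dA a b = 0 <-> a = b.

(** The relation [cw] serves two uses: in the first round adjacent vertices only have to lie over
    different levels, later the projection must preserve labels. *)
Definition pcompat (P : picture W) :=
  forall x y : P, plabel x y != 0 -> cw (pproj x) (pproj y) (plabel x y).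

Definition sits_over (P : picture W) (alpha : {ffun A -> W}) (h : {ffun A -> P}) :=
  [forall a, (pproj (h a) == alpha a) && [forall b, plabel (h a) (h b) == dA a b]].

Lemma sits_overP (P : picture W) (alpha : {ffun A -> W}) (h : {ffun A -> P}) :
  reflect ((forall a, pproj (h a) = alpha a) /\
           (forall a b, plabel (h a) (h b) = dA a b)) (sits_over alpha h).
Proof.
apply: (iffP forallP) => [H|[H1 H2] a].
  split=> [a|a b]; have /andP[/eqP h1 /forallP h2] := H a => //.
  exact/eqP.
by rewrite H1 eqxx; apply/forallP => b; rewrite H2.
Qed.

Section Step.

Variables (P : picture W) (alpha : {ffun A -> W}) (n : nat).
Hypothesis alpha_inj : injective alpha.
Hypothesis alpha_cw : forall a b, a != b -> cw (alpha a) (alpha b) (dA a b).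
Hypothesis P_sym : plabel_sym P.
Hypothesis P_compat : pcompat P.

Local Notation letter := {h : {ffun A -> P} | sits_over alpha h}.
Local Notation step_line := (n.-tuple (option letter)).
Local Notation step_vertex := ((A * n.-tuple P) + (step_line * P))%type.

Definition line_point (L : step_line) (a : A) (v : P) : n.-tuple P :=
  map_tuple (fun o : option letter => if o is Some h then val h a else v) L.

(* The amalgam has the power part [A * n.-tuple P] and, for each line [L], a
   copy of [P] meeting the power part in the points over [alpha]; the vertices
   of the form [inr (L, v)] with [v] over [alpha] are isolated. *)
Definition step_embed (L : step_line) (v : P) : step_vertex :=
  if [pick a | pproj v == alpha a] is Some a then inl (a, line_point L a v)
  else inr (L, v).

(* Along a line the coordinates carry either the label [dA a b] of a letter or
   the label of the moving pair, so the latter is recovered as the only label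
   different from [dA a b]. *)
Definition power_label (a b : A) (f g : n.-tuple P) : nat :=
  if all (fun v => pproj v == alpha a) f && all (fun v => pproj v == alpha b) g
  then match undup [seq l <- [seq plabel p.1 p.2 | p <- zip f g] | l != dA a b] with
       | [::] => dA a b
       | [:: l] => l
       | _ => 0
       end
  else 0.

Definition step_label (x y : step_vertex) : nat :=
  match x, y with
  | inl (a, f), inl (b, g) => power_label a b f g
  | _, _ =>
    if [pick t : step_line * (P * P) |
         [&& None \in t.1, step_embed t.1 t.2.1 == x & step_embed t.1 t.2.2 == y]]
      is Some t then plabel t.2.1 t.2.2 else 0
  end.

Definition step_proj (x : step_vertex) : W :=
  match x with inl (a, _) => alpha a | inr (_, v) => pproj v end.

Definition step : picture W := Picture step_label step_proj.

Lemma step_proj_embed L v : step_proj (step_embed L v) = pproj v.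
Proof. by rewrite /step_embed; case: pickP => [a /eqP|]. Qed.

Lemma step_embed_over L a v :
  pproj v = alpha a -> step_embed L v = inl (a, line_point L a v).
Proof.
move=> va; rewrite /step_embed; case: pickP => [b /eqP|/(_ a)]; rewrite va ?eqxx //.
by move/alpha_inj->.
Qed.

Lemma step_embedP L v :
  (exists2 a, pproj v = alpha a & step_embed L v = inl (a, line_point L a v)) \/
  step_embed L v = inr (L, v).
Proof.
rewrite /step_embed; case: pickP => [a /eqP va|_]; last by right.
by left; exists a.
Qed.

Lemma line_point_inj (L : step_line) a v w :
  None \in L -> line_point L a v = line_point L a w -> v = w.
Proof.
move=> /tnthP[i Li] /(congr1 (fun t => tnth t i)).
by rewrite !tnth_map -Li.
Qed.

Lemma step_embed_inj L : None \in L -> injective (step_embed L).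
Proof.
move=> NL v w E.
case: (step_embedP L v) (step_embedP L w) E => [[a va ->]|->] [[b wb ->]|->] //.
  move=> E; have ab : a = b by case: E.
  have := congr1 (fun x : step_vertex => if x is inl p then p.2 else line_point L a v) E.
  by rewrite /= -ab; apply: line_point_inj.
by case.
Qed.

Lemma letter_proj (h : letter) a : pproj (val h a) = alpha a.
Proof. by have /sits_overP[-> _] := valP h. Qed.

Lemma letter_label (h : letter) a b : plabel (val h a) (val h b) = dA a b.
Proof. by have /sits_overP[_ ->] := valP h. Qed.

Lemma line_point_over L a v :
  pproj v = alpha a -> all (fun v => pproj v == alpha a) (line_point L a v).
Proof. by move=> va; apply/allP => _ /mapP[[h|] _ ->]; rewrite ?letter_proj ?va. Qed.

Lemma power_label_line (L : step_line) a b v w :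
  None \in L -> pproj v = alpha a -> pproj w = alpha b ->
  power_label a b (line_point L a v) (line_point L b w) = plabel v w.
Proof.
move=> NL va wb; rewrite /power_label !line_point_over //= zip_map -map_comp.
have -> : [seq ((fun p => plabel p.1 p.2) \o (fun o : option letter =>
     (if o is Some h then val h a else v,
       if o is Some h then val h b else w))) o | o <- L]
  = [seq if o is Some h then dA a b else plabel v w | o : option letter <- L].
  by apply: eq_map => -[h|] //=; rewrite letter_label.
set ls := map _ _.
have lsP l : l \in ls -> (l == dA a b) || (l == plabel v w).
  by case/mapP => -[h|] _ ->; rewrite eqxx ?orbT.
have [E|N] := eqVneq (plabel v w) (dA a b).
  rewrite (_ : filter _ _ = [::]) //; apply/eqP; rewrite -(negbK (_ == _)) -has_filter.
  by apply/hasPn => l /lsP; rewrite E orbb negbK.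
rewrite (@undup_const _ (plabel v w)) //.
  by rewrite mem_filter N; apply/mapP; exists None.
by apply/allP => l; rewrite mem_filter => /andP[/negPf Nl /lsP]; rewrite Nl.
Qed.

(** An end point outside the power part names its line, so [pick] can only find this line and, by
    injectivity, this pair. In the power part the label is read off along the line. *)
Lemma step_label_embed (L : step_line) v w :
  None \in L -> step_label (step_embed L v) (step_embed L w) = plabel v w.
Proof.
move=> NL.
have pickE x y : step_embed L v = x -> step_embed L w = y ->
  (exists u, x = inr (L, u)) \/ (exists u, y = inr (L, u)) ->
  (if [pick t : step_line * (P * P) |
         [&& None \in t.1, step_embed t.1 t.2.1 == x & step_embed t.1 t.2.2 == y]]
      is Some t then plabel t.2.1 t.2.2 else 0) = plabel v w.
  move=> vx wy xy; case: pickP => [[L' [v' w']] /= /and3P[NL' /eqP v'x /eqP w'y]|].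
    have LE : L' = L.
      case: xy => -[u uE].
        by case: (step_embedP L' v') v'x => [[a _ ->]|->]; rewrite uE // => -[].
      by case: (step_embedP L' w') w'y => [[a _ ->]|->]; rewrite uE // => -[].
    rewrite {L'}LE in NL' v'x w'y *.
    by rewrite (step_embed_inj NL (etrans v'x (esym vx)))
               (step_embed_inj NL (etrans w'y (esym wy))).
  by move/(_ (L, (v, w))); rewrite /= NL vx wy !eqxx.
case: (step_embedP L v) (step_embedP L w) => [[a va vE]|vE] [[b wb wE]|wE].
- by rewrite vE wE /= power_label_line.
- by rewrite {1}vE {1}wE /=; apply: (pickE) => //; right; exists w.
- by rewrite {1}vE {1}wE /=; apply: (pickE) => //; left; exists v.
by rewrite {1}vE {1}wE /=; apply: (pickE) => //; left; exists v.
Qed.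

Definition is_power (x : step_vertex) : bool := if x is inl _ then true else false.

Lemma step_label_neq0 x y : step_label x y != 0 ->
  (is_power x && is_power y) \/
  exists L v w, [/\ None \in L, x = step_embed L v, y = step_embed L w &
                    plabel v w != 0].
Proof.
have pickE : (if [pick t : step_line * (P * P) |
         [&& None \in t.1, step_embed t.1 t.2.1 == x & step_embed t.1 t.2.2 == y]]
      is Some t then plabel t.2.1 t.2.2 else 0) != 0 ->
  exists L v w, [/\ None \in L, x = step_embed L v, y = step_embed L w &
                    plabel v w != 0].
  case: pickP => [[L [v w]] /= /and3P[NL /eqP<- /eqP<-] ?|//].
  by exists L, v, w.
by case: x y pickE => [[a f]|[L v]] [[b g]|[L' w]] pickE H; [left|right; exact: pickE..].
Qed.

Lemma power_label_neq0 a b f g : power_label a b f g != 0 ->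
  power_label a b f g = dA a b \/
  exists v w : P, [/\ pproj v = alpha a,
    pproj w = alpha b & power_label a b f g = plabel v w].
Proof.
rewrite /power_label; case: ifP => // /andP[/allP fa /allP gb].
case E: undup => [|l [|]] //; first by left.
have : l \in undup [seq l <- [seq plabel p.1 p.2 | p <- zip f g] | l != dA a b].
  by rewrite E inE.
rewrite mem_undup mem_filter => /andP[_ /mapP[[v w] /= vw ->]] _.
have [vf wg] : v \in tval f /\ w \in tval g.
  have sz : size f = size g by rewrite !size_tuple.
  split; [rewrite -(unzip1_zip (eq_leq sz))|rewrite -(unzip2_zip (eq_leq (esym sz)))].
    by apply/mapP; exists (v, w).
  by apply/mapP; exists (v, w).
by right; exists v, w; rewrite (eqP (fa _ vf)) (eqP (gb _ wg)).
Qed.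

Lemma step_sym : plabel_sym step.
Proof.
have embS x y : (exists (L : step_line) v w, [/\ None \in L, x = step_embed L v,
  y = step_embed L w &
                    plabel v w != 0]) -> step_label x y = step_label y x.
  by move=> [L [v [w [NL -> -> _]]]]; rewrite !step_label_embed.
move=> x y /=.
have [xy|Nxy] := boolP (is_power x && is_power y).
  case: x y xy => [[a f]|//] [[b g]|//] _ /=; rewrite /power_label andbC dA_sym.
  rewrite (_ : map _ (zip f g) = [seq plabel p.1 p.2 | p <- zip g f]) //.
  have -> : zip g f = map (fun p => (p.2, p.1)) (zip f g).
    by elim: (tval f) (tval g) => [|u s IH] [|w t] //=; rewrite IH.
  by rewrite -map_comp; apply: eq_map => p /=.
have [E|N] := eqVneq (step_label x y) 0.
  have [->//|N'] := eqVneq (step_label y x) 0.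
  by case: (step_label_neq0 N') => [|/embS->//]; rewrite andbC (negPf Nxy).
by case: (step_label_neq0 N) => [|/embS//]; rewrite (negPf Nxy).
Qed.

Lemma step_compat : pcompat step.
Proof.
move=> x y /= xy; case: (step_label_neq0 xy) => [|[L [v [w [NL -> -> vw]]]]].
  case: x y xy => [[a f]|//] [[b g]|//] /= xy _.
  case: (power_label_neq0 xy) => [E|[v [w [<- <- E]]]].
    rewrite E; apply: alpha_cw; apply: contraNneq xy => ab.
    by rewrite E; apply/eqP/dA_eq0.
  by rewrite E; apply: P_compat; rewrite -E.
by rewrite step_label_embed // !step_proj_embed; apply: P_compat.
Qed.

End Step.
End PartiteStep.

Section PartiteConstruction.

Variables (A : finType) (dA : A -> A -> nat) (W : finType).
Variables (cw : W -> W -> nat -> Prop).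
Hypothesis dA_sym : forall a b, dA a b = dA b a.
Hypothesis dA_eq0 : forall a b, dA a b = 0 <-> a = b.
Variables (K : finType) (k0 : K).

Definition picture_map (P Q : picture W) (phi : P -> Q) :=
  (forall v w, plabel (phi v) (phi w) = plabel v w) /\
  (forall v, pproj (phi v) = pproj v).

(** The letters are the copies of [A] over [alpha], and a word is a copy of [A] in the power part. A
    monochromatic line embeds [P] so that these copies become the words of the line. *)
Lemma step_ramsey (P : picture W) (alpha : {ffun A -> W}) : injective alpha ->
  exists n, forall chi : {ffun A -> step dA P alpha n} -> K,
  exists2 phi : P -> step dA P alpha n, picture_map phi &
    forall h1 h2, sits_over dA alpha h1 -> sits_over dA alpha h2 ->
      chi [ffun a => phi (h1 a)] = chi [ffun a => phi (h2 a)].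
Proof.
move=> ai; pose letter : finType := {h : {ffun A -> P} | sits_over dA alpha h}.
have [n Hn] := @hales_jewett_thm letter K; exists n => chi.
pose word (t : n.-tuple letter) : {ffun A -> step dA P alpha n} :=
  [ffun a => inl (a, map_tuple (fun h : letter => val h a) t)].
have [L [sL NL mL]] := Hn (fun w => if insub w is Some t then chi (word t) else k0).
pose Lt := @Tuple n _ L (introT eqP sL).
exists (step_embed Lt).
  by split=> v *; [apply: step_label_embed|apply: step_proj_embed].
have wordE (h : {ffun A -> P}) (ho : sits_over dA alpha h) :
  (if insub (subst L (Sub h ho : letter)) is Some t then chi (word t) else k0) =
  chi [ffun a => step_embed Lt (h a)].
  have sz : size (subst L (Sub h ho : letter)) == n by rewrite size_map sL.
  rewrite insubT; congr chi; apply/ffunP => a; rewrite !ffunE.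
  have /sits_overP[ha _] := ho; rewrite (step_embed_over ai _ (ha a)).
  congr (inl (_, _)); apply: val_inj => /=; rewrite /subst -map_comp.
  by apply: eq_map => -[].
by move=> h1 h2 o1 o2; rewrite -(wordE _ o1) -(wordE _ o2); apply: mL.
Qed.

Variable Inv : picture W -> Prop.

Definition admits (alpha : {ffun A -> W}) :=
  injective alpha /\ forall a b, a != b -> cw (alpha a) (alpha b) (dA a b).

Definition sound (P : picture W) := [/\ plabel_sym P, pcompat cw P & Inv P].

Hypothesis inv_step : forall P alpha n,
  sound P -> admits alpha -> Inv (step dA P alpha n).

Lemma sound_step P alpha n : sound P -> admits alpha -> sound (step dA P alpha n).
Proof.
move=> sP aP; have [Ps Pc _] := sP; have [ai ac] := aP.
by split; [exact: step_sym|exact: step_compat|exact: inv_step].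
Qed.

(** Colours are made constant in reverse order: [psi] settles the later base copies, then [phi]
    settles [alpha] for the colouring pulled back along [psi]. Since [phi] respects labels and
    projections, nothing is lost over the later ones. *)
Lemma steps_ramsey (s : seq {ffun A -> W}) (P : picture W) :
  (forall alpha, alpha \in s -> admits alpha) -> sound P ->
  exists2 Q, sound Q & forall chi : {ffun A -> Q} -> K,
  exists2 phi : P -> Q, picture_map phi &
    forall alpha h1 h2, alpha \in s ->
      sits_over dA alpha h1 -> sits_over dA alpha h2 ->
      chi [ffun a => phi (h1 a)] = chi [ffun a => phi (h2 a)].
Proof.
elim: s P => [|alpha s IH] P Hs sP.
  by exists P => // chi; exists id.
have aP : admits alpha by apply: Hs; rewrite mem_head.
have [n Hn] := step_ramsey P aP.1.
have [|Q sQ HQ] := IH _ _ (sound_step n sP aP).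
  by move=> beta bs; apply: Hs; rewrite inE bs orbT.
exists Q => // chi; have [psi [psil psip] psim] := HQ chi.
have [phi [phil phip] phim] :=
  Hn (fun h : {ffun A -> step dA P alpha n} => chi [ffun a => psi (h a)]).
have compE (h : {ffun A -> P}) :
  [ffun a => psi ([ffun a => phi (h a)] a)] = [ffun a => psi (phi (h a))].
  by apply/ffunP => a; rewrite !ffunE.
exists (psi \o phi); first by split=> v *; rewrite /= ?psil ?psip ?phil ?phip.
move=> beta h1 h2; rewrite inE => /predU1P[->|bs] o1 o2.
  by have := phim h1 h2 o1 o2; rewrite !compE.
have push (h : {ffun A -> P}) : sits_over dA beta h ->
  sits_over dA beta [ffun a => phi (h a)].
  move=> /sits_overP[hb hl]; apply/sits_overP.
  by split=> [a|a b]; rewrite !ffunE ?phip ?phil.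
by have := psim beta _ _ bs (push _ o1) (push _ o2); rewrite !compE.
Qed.

Variables (B : finType) (dB : B -> B -> nat).
Hypothesis dB_sym : forall a b, dB a b = dB b a.
Hypothesis dB_eq0 : forall a b, dB a b = 0 <-> a = b.
Variables (emb : pred {ffun A -> B}) (bases : pred {ffun B -> W}).
Hypothesis emb_dist : forall g, emb g -> forall a b, dB (g a) (g b) = dA a b.
Hypothesis bases_cw : forall beta, bases beta ->
  forall x y, x != y -> cw (beta x) (beta y) (dB x y).
Hypothesis bases_inj : forall beta, bases beta -> injective beta.

Definition comp_ffun (X Y Z : finType) (f : Y -> Z) (g : {ffun X -> Y}) : {ffun X -> Z} :=
  [ffun x => f (g x)].

(** The partition arrow for maps instead of sets; between linearly ordered structures an embedding
    is determined by its image. *)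
Definition arrow (V : finType) (copies : {ffun B -> V} -> Prop) : Prop :=
  forall chi : {ffun A -> V} -> K, exists2 f : {ffun B -> V}, copies f &
    forall g1 g2, emb g1 -> emb g2 ->
      chi (comp_ffun f g1) = chi (comp_ffun f g2).

(** The initial picture has one copy of [B] over each base copy; the points of maps outside [bases]
    are isolated and keep the vertex type a product. *)
Definition disjoint_copies : picture W :=
  @Picture W ({ffun B -> W} * B)%type
    (fun p q => if (p.1 == q.1) && bases p.1 then dB p.2 q.2 else 0)
    (fun p => p.1 p.2).

Hypothesis inv_disjoint : Inv disjoint_copies.

Lemma sound_disjoint : sound disjoint_copies.
Proof.
split=> // [[b x] [c y]|[b x] [c y]] /=.
  by have [->|_] /= := eqVneq b c; rewrite // dB_sym.
case: ifP => // /andP[/eqP<- bb] xy.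
by apply: bases_cw => //; apply: contraNneq xy => ->; apply/eqP/dB_eq0.
Qed.

(** After one step for each base copy of [A], the colour of a copy in the image of [phi] depends
    only on its projection. This colours the maps into the base, with the dummy [k0] where no copy
    lies above, and the arrow of the base applies. *)
Theorem partite_construction : arrow bases ->
  exists2 Q, sound Q & arrow (fun f : {ffun B -> Q} =>
    (forall x y, plabel (f x) (f y) = dB x y) /\ bases [ffun x => pproj (f x)]).
Proof.
move=> arr.
pose s := [seq comp_ffun beta g | beta : {ffun B -> W} <- enum bases, g : {ffun A ->
  B} <- enum emb].
have [|Q sQ HQ] := @steps_ramsey s _ _ sound_disjoint.
  move=> _ /allpairsP[[beta g] /= [bb gg ->]].
  rewrite !mem_enum in bb gg; split=> [a b|a b ab]; rewrite !ffunE.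
    move/(bases_inj bb) => /(congr1 (dB^~ (g b))).
    by rewrite (proj2 (dB_eq0 _ _) erefl) emb_dist // => /dA_eq0.
  rewrite -(emb_dist gg); apply: bases_cw => //; apply: contraNneq ab => E.
  by apply/eqP/dA_eq0; rewrite -(emb_dist gg) E; apply/dB_eq0.
exists Q => // chi; have [phi [phil phip] phim] := HQ chi.
pose copy (beta : {ffun B -> W}) (g : {ffun A -> B}) : {ffun A -> disjoint_copies} :=
  [ffun a => (beta, g a)].
have copyP beta g : bases beta -> emb g -> sits_over dA (comp_ffun beta g) (copy beta g).
  move=> bb gg; apply/sits_overP; split=> [a|a b]; rewrite !ffunE //=.
  by rewrite eqxx bb emb_dist.
have [beta bb betam] := arr (fun alpha =>
  if [pick h : {ffun A -> disjoint_copies} | sits_over dA alpha h] is Some h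
  then chi (comp_ffun phi h) else k0).
exists [ffun x => phi (beta, x)].
  split=> [x y|]; first by rewrite !ffunE phil /= eqxx bb.
  by rewrite (_ : finfun _ = beta) //; apply/ffunP => x; rewrite !ffunE phip.
have E g : emb g ->
  chi (comp_ffun [ffun x => phi (beta, x)] g) =
  (if [pick h : {ffun A -> disjoint_copies} | sits_over dA (comp_ffun beta g) h] is Some h
   then chi (comp_ffun phi h) else k0).
  move=> gg; case: pickP => [h ho|/(_ (copy beta g))]; last by rewrite copyP.
  have gs : comp_ffun beta g \in s.
    by apply/allpairsP; exists (beta, g); rewrite !mem_enum.
  rewrite -(phim _ _ _ gs (copyP _ _ bb gg) ho); congr chi.
  by apply/ffunP => a; rewrite !ffunE.
by move=> g1 g2 gg1 gg2; rewrite !E //; apply: betam.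
Qed.

End PartiteConstruction.

(** * Closed walks *)

Section Reach.

Variable tri : nat -> nat -> nat -> Prop.

(* [reach w c]: the end points of a path labelled [w] can be at distance [c]. *)
Fixpoint reach (w : seq nat) (c : nat) : Prop :=
  if w is a :: w' then exists2 x, reach w' x & tri a x c else c = 0.

(** The third clause is four-point amalgamation, read as associativity of composing labels; the last
    two make [0] neutral. *)
Definition label_algebra : Prop :=
  [/\ forall a b c, tri a b c -> tri b c a,
      forall a b c, tri a b c -> tri b a c,
      forall a b c e x, tri a b x -> tri x c e -> exists2 y, tri b c y & tri a y e,
      forall a c, tri a 0 c -> a = c &
      tri 0 0 0 /\ forall a b c, tri a b c -> tri a a 0].

Hypothesis trialg : label_algebra.

Lemma reach_refl w c : reach w c -> tri c c 0.
Proof.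
have [rot _ _ _ [t0 refl]] := trialg.
case: w => [->//|a w /= [x _ t]].
exact: refl (rot _ _ _ (rot _ _ _ t)).
Qed.

Lemma reach_cat w1 w2 x y c : reach w1 x -> reach w2 y -> tri x y c ->
  reach (w1 ++ w2) c.
Proof.
have [rot swap assoc id0 [t0 refl]] := trialg.
elim: w1 x c => [x c -> r2 t|a w1 IH x c /= [u r1 t1] r2 t2] /=.
  by rewrite -(id0 y c) //; apply: swap.
by have [z uyz azc] := assoc _ _ _ _ _ t1 t2; exists z => //; apply: IH r1 r2 uyz.
Qed.

Lemma reach_catE w1 w2 c : reach (w1 ++ w2) c ->
  exists x y, [/\ reach w1 x, reach w2 y & tri x y c].
Proof.
have [rot swap assoc id0 [t0 refl]] := trialg.
elim: w1 c => [c r|a w1 IH c /= [z /IH[x [y [r1 r2 t]]] azc]] /=.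
  by exists 0, c; split=> //; exact: (rot _ _ _ (rot _ _ _ (reach_refl r))).
have [u u1 u2] := assoc y x a c z (swap _ _ _ t) (swap _ _ _ azc).
exists u, y; split=> //; last exact: swap.
by exists x => //; apply: swap.
Qed.

Lemma reach_closed w1 w2 c : reach w1 c -> reach w2 c -> reach (w1 ++ w2) 0.
Proof. by move=> r1 r2; apply: reach_cat r1 r2 (reach_refl r1). Qed.

Lemma reach_closedE w1 w2 : reach (w1 ++ w2) 0 -> exists2 c, reach w1 c & reach w2 c.
Proof.
have [rot swap assoc id0 _] := trialg.
move=> /reach_catE[x [y [r1 r2 /rot/rot/swap t]]]; exists x => //.
by rewrite (id0 x y).
Qed.

Lemma reach_rot w1 w2 : reach (w1 ++ w2) 0 -> reach (w2 ++ w1) 0.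
Proof. by move=> /reach_closedE[c r1 r2]; apply: reach_closed r2 r1. Qed.

Lemma reach_chord w c : reach (rcons w c) 0 -> reach w c.
Proof.
have [rot swap assoc id0 _] := trialg.
rewrite -cats1 => /reach_closedE[x r [y /= -> t]].
by rewrite (id0 c x).
Qed.

Lemma reach_metric (T : Type) (dist : T -> T -> nat) x s :
  (forall a, dist a a = 0) ->
  (forall a b c, tri (dist a b) (dist b c) (dist a c)) ->
  reach (pairmap dist x s) (dist x (last x s)).
Proof.
move=> d0 dt; elim: s x => [|y s IH] x /=; first exact: d0.
by exists (dist y (last y s)).
Qed.

Definition clabels (T : Type) (e : T -> T -> nat) (c : seq T) : seq nat :=
  if c is x :: p then pairmap e x (rcons p x) else [::].

Definition good (n : nat) (T : Type) (e : T -> T -> nat) : Prop :=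
  forall c, size c <= n -> cycle (fun x y => e x y != 0) c -> reach (clabels e c) 0.

Lemma clabels_cat (T : Type) (e : T -> T -> nat) x p y q :
  clabels e ((x :: p) ++ y :: q) =
  pairmap e x (rcons p y) ++ pairmap e y (rcons q x).
Proof. by rewrite /= rcons_cat rcons_cons -cat_rcons pairmap_cat last_rcons. Qed.

Lemma reach_clabels_rot (T : Type) (e : T -> T -> nat) p q :
  reach (clabels e (p ++ q)) 0 -> reach (clabels e (q ++ p)) 0.
Proof.
case: p q => [|x p] [|y q]; rewrite ?cats0 //.
by rewrite !clabels_cat => /reach_rot.
Qed.

Lemma pairmap_map (S T : Type) (f : S -> T) (e : T -> T -> nat) x s :
  pairmap e (f x) (map f s) = pairmap (fun x y => e (f x) (f y)) x s.
Proof. by elim: s x => //= y s IH x; rewrite IH. Qed.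

Lemma eq_pairmap (T : Type) (e1 e2 : T -> T -> nat) x s :
  (forall x y, e1 x y = e2 x y) -> pairmap e1 x s = pairmap e2 x s.
Proof. by move=> H; elim: s x => //= y s IH x; rewrite H IH. Qed.

Lemma first_split (T : Type) (a : pred T) s : has a s ->
  exists s1 x s2, [/\ s = s1 ++ x :: s2, a x & ~~ has a s1].
Proof.
elim: s => //= y s IH; have [ay _|Nay /= /IH[s1 [x [s2 [-> ax Ns]]]]] := boolP (a y).
  by exists [::], y, s.
by exists (y :: s1), x, s2; rewrite /= (negPf Nay).
Qed.

Lemma last_split (T : Type) (a : pred T) s : has a s ->
  exists s1 x s2, [/\ s = s1 ++ x :: s2, a x & ~~ has a s2].
Proof.
rewrite -has_rev => /first_split[s1 [x [s2 [E ax Ns]]]].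
exists (rev s2), x, (rev s1); rewrite has_rev; split=> //.
by rewrite -[LHS]revK E rev_cat rev_cons cat_rcons.
Qed.

(** * Closed walks in one partite step *)

Section GoodStep.

Variables (A : finType) (dA : A -> A -> nat) (W : finType) (eW : W -> W -> nat).
Hypothesis dA_sym : forall a b, dA a b = dA b a.
Hypothesis dA_eq0 : forall a b, dA a b = 0 <-> a = b.
Hypothesis dA_tri : forall a b c, tri (dA a b) (dA b c) (dA a c).
Hypothesis eW_irr : forall w, eW w w = 0.
Variable m : nat.
Hypothesis eW_good : good m eW.

Local Notation cw := (fun w w' l => eW w w' = l).

Variables (P : picture W) (alpha : {ffun A -> W}) (n : nat).
Hypothesis alpha_inj : injective alpha.
Hypothesis alpha_cw : forall a b, a != b -> eW (alpha a) (alpha b) = dA a b.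
Hypothesis P_sym : plabel_sym P.
Hypothesis P_compat : pcompat cw P.
Hypothesis P_good : good m.+1 (@plabel _ P).

Local Notation Q := (step dA P alpha n).
Local Notation "x ~~> y" := (@plabel _ Q x y != 0) (at level 70).

Local Notation power := (@is_power A dA W P alpha n : pred Q).

Let Q_sym : plabel_sym Q. Proof. exact: step_sym. Qed.
Let Q_compat : pcompat cw Q. Proof. exact: step_compat. Qed.

Let proj_path (x : Q) s : path (fun x y => x ~~> y) x s ->
  pairmap (@plabel _ Q) x s = pairmap eW (pproj x) (map (@pproj _ Q) s) /\
  path (fun w w' => eW w w' != 0) (pproj x) (map (@pproj _ Q) s).
Proof.
elim: s x => //= y s IH x /andP[xy /IH[-> ->]].
by rewrite (Q_compat xy) xy.
Qed.

(** The chord from [alpha b] back to [alpha a] completes a closed walk of at most [m] edges in the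
    base; for [a = b] the walk is closed already. *)
Lemma reach_base_chord a b ws :
  last (alpha a) ws = alpha b -> size ws < m ->
  path (fun w w' => eW w w' != 0) (alpha a) ws ->
  reach (pairmap eW (alpha a) ws) (dA a b).
Proof.
move=> lb sm sp; have [ab|ab] := eqVneq a b.
  rewrite -{}ab (proj2 (dA_eq0 a a) erefl) in lb *.
  case/lastP: ws sm sp lb => [//|ws y]; rewrite size_rcons last_rcons => sm sp yE.
  rewrite {}yE in sp *; apply: (eW_good (c := alpha a :: ws)) => //.
  exact: ltnW.
have ba : eW (alpha b) (alpha a) = dA a b by rewrite alpha_cw 1?eq_sym // dA_sym.
apply: reach_chord.
have -> : rcons (pairmap eW (alpha a) ws) (dA a b) = clabels eW (alpha a :: ws).
  by rewrite /= -[in RHS]cats1 pairmap_cat /= lb ba cats1.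
apply: eW_good => //; rewrite /= rcons_path sp lb ba.
by apply/eqP => /dA_eq0 E; rewrite E eqxx in ab.
Qed.

(* The end points of the walk lie in the power part, so in the base they are
   joined by an edge of the copy of [A] or coincide. *)
Lemma reach_power_chord (x : Q) s a b f g :
  x = inl (a, f) -> last x s = inl (b, g) -> size s < m ->
  path (fun x y => x ~~> y) x s -> reach (pairmap (@plabel _ Q) x s) (dA a b).
Proof.
move=> xa lb sm /proj_path[-> sp].
have px : pproj x = alpha a by rewrite xa.
rewrite px in sp *; apply: reach_base_chord => //; last by rewrite size_map.
by rewrite -px (last_map (@pproj _ Q)) lb.
Qed.

Lemma adj_embed (L : n.-tuple (option {h | sits_over dA alpha h})) v (y : Q) :
  (inr (L, v) : Q) ~~> y ->
  [/\ None \in L, inr (L, v) = step_embed L v & exists w, y = step_embed L w].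
Proof.
case/step_label_neq0 => [//|[L' [v' [w [NL E -> _]]]]].
case: (step_embedP L' v') E => [[a _ ->]//|E' E].
have [LE vE] : L = L' /\ v = v' by move: E; rewrite E' => -[].
by rewrite LE vE; split=> //; exists w.
Qed.

Definition in_copy (L : n.-tuple (option {h | sits_over dA alpha h})) (x : Q) :=
  exists v, x = step_embed L v.

Lemma in_copy_adj L (x y : Q) : ~~ is_power x -> in_copy L x -> x ~~> y -> in_copy L y.
Proof.
move=> Nx [v xv]; case: (step_embedP L v) xv => [[a _ ->] xa|-> ->].
  by rewrite xa in Nx.
by case/adj_embed.
Qed.

Lemma in_copy_forward L (x : Q) s : in_copy L x -> path (fun x y => x ~~> y) x s ->
  ~~ has power (belast x s) ->
  forall y, y \in s -> in_copy L y.
Proof.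
elim: s x => //= z s IH x xL /andP[xz zs]; rewrite negb_or => /andP[Nx Ns] y.
have zL := in_copy_adj Nx xL xz.
by rewrite inE => /predU1P[->//|]; apply: IH zL zs Ns y.
Qed.

Lemma in_copy_backward L (x z : Q) s : ~~ is_power z -> in_copy L z ->
  path (fun x y => x ~~> y) x (rcons s z) ->
  ~~ has power s ->
  forall y, y \in x :: s -> in_copy L y.
Proof.
move=> Nz zL; elim: s x => [|u s IH] x /=.
  rewrite andbT => xz _ y; rewrite inE => /eqP->.
  by apply: in_copy_adj Nz zL _; rewrite Q_sym.
move=> /andP[xu us]; rewrite negb_or => /andP[Nu Ns] y.
have uL := IH u us Ns.
rewrite inE => /predU1P[->|]; last exact: uL.
by apply: in_copy_adj Nu (uL u (mem_head _ _)) _; rewrite Q_sym.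
Qed.

Lemma reach_in_copy (L : n.-tuple (option {h | sits_over dA alpha h})) (c : seq Q) :
  None \in L -> size c <= m.+1 -> cycle (fun x y => x ~~> y) c ->
  (forall x, x \in c -> in_copy L x) -> reach (clabels (@plabel _ Q) c) 0.
Proof.
move=> NL cm cc cL.
have [c' cE] : exists c' : seq P, c = map (step_embed L) c'.
  elim: c cL {cm cc} => [|x c IH] cL; first by exists [::].
  have [v ->] := cL x (mem_head _ _); have [|c' ->] := IH.
    by move=> y yc; apply: cL; rewrite inE yc orbT.
  by exists (v :: c').
have lE v w : @plabel _ Q (step_embed L v) (step_embed L w) = plabel v w.
  exact: step_label_embed.
have -> : clabels (@plabel _ Q) c = clabels (@plabel _ P) c'.
  rewrite cE; case: (c') => //= v p; rewrite -map_rcons pairmap_map.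
  exact: eq_pairmap.
apply: P_good; first by move: cm; rewrite cE size_map.
move: cc; rewrite cE (mono_cycle (e := fun v w : P => plabel v w != 0)) // => v w.
by rewrite lE.
Qed.

(** By compatibility with the base, an edge inside the power part carries the distance of its first
    components, so this is a walk in the metric space on [A]. *)
Lemma reach_power (c : seq Q) : cycle (fun x y => x ~~> y) c ->
  all power c -> reach (clabels (@plabel _ Q) c) 0.
Proof.
case: c => // x p cc pc.
have [a0 [f0 x0]] : exists a f, x = inl (a, f).
  by case: (x) pc => [[a f] _|//]; exists a, f.
pose base (y : Q) := if y is inl (a, _) then a else a0.
have lE (y z : Q) : y ~~> z -> is_power y -> is_power z ->
  plabel y z = dA (base y) (base z).
  move=> yz; have := Q_compat yz; case: y z yz => [[a f]|//] [[b g]|//] yz /= E _ _.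
  rewrite -E; have [ab|/alpha_cw//] := eqVneq a b.
  by rewrite ab eW_irr (proj2 (dA_eq0 b b) erefl).
have labE s (y : Q) : is_power y -> path (fun x y => x ~~> y) y s -> all power s ->
  pairmap (@plabel _ Q) y s = pairmap dA (base y) (map base s).
  elim: s y => //= z s IH y yp /andP[yz zs] /andP[zp sp].
  by congr (_ :: _); [exact: lE|exact: IH].
have E : clabels (@plabel _ Q) (x :: p) = pairmap dA (base x) (map base (rcons p x)).
  by apply: labE => //; [rewrite x0|rewrite all_rcons].
have := @reach_metric A dA (base x) (map base (rcons p x)).
rewrite -E last_map last_rcons (proj2 (dA_eq0 _ _) erefl); apply=> // a.
exact/dA_eq0.
Qed.

(* A closed walk that stays in no copy of [P] meets the power part in two
   vertices that are not consecutive on it.  The chord between their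
   projections cuts the projected walk into two shorter closed walks. *)
Theorem good_step : good m.+1 (@plabel _ Q).
Proof.
move=> c cm cc.
have [pc|] := boolP (all power c); first exact: reach_power.
(* Rotate the walk to start at a vertex [z] outside the power part; its copy of [P] is followed
   until the power part is reached. *)
rewrite -has_predC => /first_split[c1 [z [c2 [cE zN _]]]].
rewrite cE; apply: reach_clabels_rot; rewrite cat_cons; rewrite /= in zN.
have {}cc : cycle (fun x y => x ~~> y) (z :: c2 ++ c1).
  by rewrite -cat_cons cycle_catC -cE.
have {}cm : size (z :: c2 ++ c1) <= m.+1.
  by move: cm; rewrite cE -cat_cons !size_cat addnC.
move: (c2 ++ c1) cc cm => p cc cm {c c1 c2 cE}.
have [L [NL zL]] : exists L, None \in L /\ in_copy L z.
  case: z zN cc cm => [//|[L v]] _ cc _; exists L.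
  by case: p cc => [|y p] /= /andP[/adj_embed[NL E _] _]; split=> //; exists v.
have [hp|Np] := boolP (has power p); last first.
  apply: (reach_in_copy NL) => // x; rewrite inE => /predU1P[->//|xp].
  apply: (in_copy_forward zL cc); last by rewrite mem_rcons inE xp orbT.
  by rewrite belast_rcons /= negb_or zN.
have [p1 [e1 [p2 [pE e1P Np1]]]] := first_split hp.
have e1p2 : has power (e1 :: p2) by rewrite /= e1P.
have [p3 [e2 [p4 [p34 e2P Np4]]]] := last_split e1p2.
have pE' : p = p1 ++ p3 ++ e2 :: p4 by rewrite pE p34.
have front x : x \in rcons p1 e1 -> in_copy L x.
  apply: (in_copy_forward zL); last by rewrite belast_rcons /= negb_or zN.
  by move: cc; rewrite /= pE -cat_rcons rcons_cat cat_path => /andP[].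
have back x : x \in e2 :: p4 -> in_copy L x.
  apply: (in_copy_backward zN zL) => //.
  by move: cc; rewrite /= pE' catA rcons_cat cat_path /= => /and3P[].
(* If [e1] and [e2] coincide or are consecutive, the whole walk lies in one copy. *)
case: p3 p34 pE' => [|y1 [|y p5]]; rewrite ?cat_cons ?cat0s.
- case=> E1 E2 pE'; apply: (reach_in_copy NL) => // x.
  rewrite pE' inE mem_cat => /predU1P[->//|/orP[xp|]]; last exact: back.
  by apply: front; rewrite mem_rcons inE xp orbT.
- case=> E1 E2 pE'; apply: (reach_in_copy NL) => // x.
  rewrite pE' inE mem_cat inE => /predU1P[->//|/or3P[xp|/eqP->|]]; last exact: back.
    by apply: front; rewrite mem_rcons inE xp orbT.
  by apply: front; rewrite -E1 mem_rcons mem_head.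
case=> <- {y1} p2E pE'.
have cyc : cycle (fun x y => x ~~> y) ((e1 :: y :: p5) ++ e2 :: p4 ++ z :: p1).
  rewrite (_ : _ ++ _ = ((e1 :: y :: p5) ++ e2 :: p4) ++ z :: p1); last by rewrite -catA.
  by rewrite cycle_catC; move: cc; rewrite pE'.
rewrite pE' -cat_cons; apply: reach_clabels_rot.
rewrite (_ : _ ++ _ = (e1 :: y :: p5) ++ e2 :: (p4 ++ z :: p1)); last first.
  by rewrite -!cat_cons -catA.
(* Since [y] and [z] lie on different sides of the chord, each side together with the chord has at
   most [m] edges. *)
have sz : size p1 + size p5 + size p4 + 4 <= m.+1.
  have : size p = size p1 + (size p5 + (size p4).+1).+2.
    by rewrite pE' size_cat /= size_cat.
  by move: cm => /=; clear; move: (size p) (size p1) (size p5) (size p4); lia.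
have [cyc1 cyc2] : path (fun x y => x ~~> y) e1 (rcons (y :: p5) e2) /\
    path (fun x y => x ~~> y) e2 (rcons (p4 ++ z :: p1) e1).
  by move: cyc; rewrite cat_cons /cycle rcons_cat rcons_cons -cat_rcons cat_path
       last_rcons => /andP[].
have [a [f E1]] : exists a f, e1 = inl (a, f).
  by case: (e1) e1P => [[a f] _|//]; exists a, f.
have [b [g E2]] : exists b g, e2 = inl (b, g).
  by case: (e2) e2P => [[b g] _|//]; exists b, g.
have L1 : last e1 (rcons (y :: p5) e2) = inl (b, g) by rewrite last_rcons.
have L2 : last e2 (rcons (p4 ++ z :: p1) e1) = inl (a, f) by rewrite last_rcons.
have S1 : size (rcons (y :: p5) e2) < m.
  by rewrite size_rcons /=; move: sz; clear; move: (size p1) (size p5) (size p4); lia.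
have S2 : size (rcons (p4 ++ z :: p1) e1) < m.
  by rewrite size_rcons size_cat /=; move: sz; clear;
    move: (size p1) (size p5) (size p4); lia.
rewrite clabels_cat; apply: (@reach_closed _ _ (dA a b)).
  by apply: (reach_power_chord E1 L1 S1 cyc1).
by rewrite dA_sym; apply: (reach_power_chord E2 L2 S2 cyc2).
Qed.

End GoodStep.

Lemma good_disjoint (B : finType) (dB : B -> B -> nat) (W : finType)
    (bases : pred {ffun B -> W}) n :
  (forall a b, dB a b = 0 <-> a = b) ->
  (forall a b c, tri (dB a b) (dB b c) (dB a c)) ->
  good n (@plabel _ (disjoint_copies dB bases)).
Proof.
move=> dB0 dBt [//|[beta x] p] _ cc.
set e := @plabel _ _ in cc *.
have walk s (q : disjoint_copies dB bases) :
   path (fun u v => e u v != 0) q s -> pairmap e q s = pairmap dB q.2 (map snd s).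
  elim: s q => //= r s IH q /andP[qr rs]; rewrite IH //; congr (_ :: _).
  by move: qr; rewrite /e /=; case: ifP.
rewrite /clabels walk // map_rcons.
have := @reach_metric B dB x (rcons (map snd p) x).
rewrite last_rcons (proj2 (dB0 x x) erefl); apply=> // a.
exact/dB0.
Qed.

End Reach.

(** * Increasing maps and iteration of the construction *)

Lemma map_nth_index (S T : eqType) (x0 : T) (t : seq S) (s : seq T) :
  uniq t -> size s = size t -> [seq nth x0 s (index x t) | x <- t] = s.
Proof.
move=> ut st; apply: (@eq_from_nth _ x0); first by rewrite size_map.
move=> i; rewrite size_map => it; case: t ut st it => [//|y t] ut st it.
by rewrite (nth_map y) // index_uniq.
Qed.

Section OrderedArrow.

Variables (A B : finType) (leA : rel A) (leB : rel B).
Hypotheses (leA_lin : linear_order leA) (leB_lin : linear_order leB).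

Lemma linear_sort (T : finType) (le : rel T) : linear_order le ->
  [/\ sorted le (sort le (enum T)), uniq (sort le (enum T)),
      size (sort le (enum T)) = #|T| & forall x, x \in sort le (enum T)].
Proof.
move=> [_ _ tot]; split; first exact: sort_sorted.
- by rewrite sort_uniq enum_uniq.
- by rewrite size_sort cardE.
by move=> x; rewrite mem_sort mem_enum.
Qed.

Local Notation sA := (sort leA (enum A)).
Local Notation sB := (sort leB (enum B)).

Definition increasing (r : nat) (beta : {ffun B -> 'I_r}) : bool :=
  [forall x, forall y, (x != y) && leB x y ==> (beta x < beta y)].

Lemma increasingP r (beta : {ffun B -> 'I_r}) :
  reflect (forall x y, x != y -> leB x y -> beta x < beta y) (increasing beta).
Proof.
apply: (iffP forallP) => [H x y xy lxy|H x].
  by have /forallP/(_ y)/implyP := H x; apply; rewrite xy.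
by apply/forallP => y; apply/implyP => /andP[]; apply: H.
Qed.

Lemma increasing_inj r (beta : {ffun B -> 'I_r}) : increasing beta -> injective beta.
Proof.
have [_ _ tot] := leB_lin.
move=> /increasingP H x y E; apply/eqP; apply: contraT => xy.
have /orP[/(H _ _ xy)|] := tot x y; first by rewrite E ltnn.
by move=> lyx; have := H y x; rewrite eq_sym xy E ltnn => /(_ isT lyx).
Qed.

(** Listing [A] and [B] in their orders turns increasing maps into subsequences of the levels, and
    embeddings of [A] into subsequences of those. The extra level in [r.+1] only supplies the
    default [ord0]. *)
Lemma ramsey_increasing (K : finType) (emb : pred {ffun A -> B}) :
  (forall g, emb g -> injective g /\ forall a b, leB (g a) (g b) = leA a b) ->
  exists r, @arrow A K B emb _ (@increasing r).
Proof.
move=> embP.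
have [sortA uniqA sizeA memA] := linear_sort leA_lin.
have [sortB uniqB sizeB memB] := linear_sort leB_lin.
have [antiB transB totB] := leB_lin.
have [r Hr] := ramsey_subseq K #|A| #|B|; exists r.+1 => chi.
pose fA (t : seq 'I_r.+1) : {ffun A -> 'I_r.+1} := [ffun a => nth ord0 t (index a sA)].
have [|s [sub sz mono]] := Hr _ (fun t => chi (fA t)) (enum 'I_r.+1).
  by rewrite size_enum_ord.
pose beta : {ffun B -> 'I_r.+1} := [ffun x => nth ord0 s (index x sB)].
have betaE : map beta sB = s.
  rewrite -[RHS](@map_nth_index _ _ ord0 sB s uniqB) ?sizeB ?sz //.
  by apply: eq_map => x; rewrite ffunE.
have sortS : sorted ltn (map val s).
  apply: (subseq_sorted ltn_trans (map_subseq val sub)).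
  by rewrite val_enum_ord iota_ltn_sorted.
exists beta.
  apply/increasingP => x y xy lxy; rewrite !ffunE.
  have xB : index x sB < size s by rewrite sz -sizeB index_mem.
  have yB : index y sB < size s by rewrite sz -sizeB index_mem.
  have ixy : index x sB < index y sB.
    rewrite ltnNge; apply: contra xy => iyx.
    have refl : reflexive leB by move=> z; have := totB z z; rewrite orbb.
    have lyx := sorted_leq_index transB refl sortB y x (memB y) (memB x) iyx.
    by apply/eqP; apply: antiB; rewrite lxy lyx.
  have /(_ _ _ _ _ ixy) := sorted_ltn_nth ltn_trans 0 sortS.
  by rewrite !(nth_map ord0) // !inE !size_map; apply.
have embE g : emb g -> comp_ffun beta g = fA (map beta (map g sA)).
  move=> gg; apply/ffunP => a; rewrite !ffunE -map_comp (nth_map a) ?index_mem //.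
  by rewrite nth_index //= ffunE.
have embS g : emb g -> subseq (map beta (map g sA)) s.
  move=> gg; have [gi gl] := embP g gg; rewrite -betaE; apply: map_subseq.
  suff -> : map g sA = [seq x <- sB | x \in map g sA] by exact: filter_subseq.
  apply: (sorted_eq transB antiB).
  - by rewrite sorted_map; move: sortA; congr is_true; apply: eq_sorted => a b /=.
  - exact: sorted_filter.
  apply: uniq_perm; rewrite ?filter_uniq ?map_inj_uniq //.
  by move=> x; rewrite mem_filter memB andbT.
move=> g1 g2 e1 e2; rewrite !embE //.
by apply: mono; rewrite ?embS // !size_map sizeA.
Qed.

End OrderedArrow.

Section GoodArrow.

Variable tri : nat -> nat -> nat -> Prop.
Hypothesis trialg : label_algebra tri.
Variables (A B : expansion).
Hypotheses (A_lin : linear_order (@ordle A)) (B_lin : linear_order (@ordle B)).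
Hypothesis A_tri : forall a b c : A, tri (dist a b) (dist b c) (dist a c).
Hypothesis B_tri : forall a b c : B, tri (dist a b) (dist b c) (dist a c).
Variables (K : finType) (k0 : K).

Definition embb (g : {ffun A -> B}) : bool :=
  [forall a, forall b,
    (dist (g a) (g b) == dist a b) && (ordle (g a) (g b) == ordle a b)].

Lemma embbP (g : {ffun A -> B}) :
  reflect (forall a b, dist (g a) (g b) = dist a b /\ ordle (g a) (g b) = ordle a b)
          (embb g).
Proof.
apply: (iffP forallP) => [H a b|H a].
  by have /forallP/(_ b)/andP[/eqP-> /eqP->] := H a.
by apply/forallP => b; have [-> ->] := H a b; rewrite !eqxx.
Qed.

Lemma dist_id (X : intMetric) (x y : X) : dist x y = 0 -> x = y.
Proof. by move/dist_eq0. Qed.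

Lemma distxx (X : intMetric) (x : X) : dist x x = 0.
Proof. exact/dist_eq0. Qed.

Definition copy_of_B (V : finType) (e : V -> V -> nat) r (q : V -> 'I_r)
    (f : {ffun B -> V}) : bool :=
  [forall x, forall y, e (f x) (f y) == dist x y] &&
  increasing (@ordle B) [ffun x => q (f x)].

(* The levels [q] carry the linear order: adjacent vertices lie on different
   levels. *)
Definition good_arrow n : Prop :=
  exists (V : finType) (e : V -> V -> nat) (r : nat) (q : V -> 'I_r),
    [/\ forall x y, e x y = e y x, forall x y, e x y != 0 -> q x != q y,
        good tri n e & @arrow A K B embb _ (copy_of_B e q)].

(** The first base is the set of levels from Ramsey's theorem; each further round takes the previous
    graph as base and pulls its levels back along the projection. *)
Theorem good_arrow_exists n : good_arrow n.
Proof.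
have embb_dist g : embb g -> forall a b, dist (g a) (g b) = dist a b.
  by move=> /embbP H a b; have [] := H a b.
elim: n => [|n [W [eW [r [q [eWs eWq eWg arr]]]]]].
- have [r arr] : exists r, @arrow A K B embb _ (@increasing B (@ordle B) r).
    apply: (ramsey_increasing A_lin B_lin) => g /embbP H; split=> [a b E|a b].
      by apply: dist_id; have [<- _] := H a b; rewrite E distxx.
    by have [] := H a b.
  have [||||Q [Qs Qc _] Qa] := @partite_construction A (@dist A) 'I_r
    (fun i j _ => i != j) (@dist_sym A) (@dist_eq0 A) K k0 (fun=> True) _ B (@dist B)
    (@dist_sym B) (@dist_eq0 B) embb (@increasing B (@ordle B) r) embb_dist _ _ _ arr => //.
  + by move=> beta /(increasing_inj B_lin) bi x y; apply: contraNneq => /bi->.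
  + by move=> beta; apply: increasing_inj.
  exists Q, (@plabel _ Q), r, (@pproj _ Q); split=> //.
    by case.
  move=> chi; have [f [fl fp] fm] := Qa chi; exists f => //.
  rewrite /copy_of_B fp andbT; apply/forallP => x; apply/forallP => y.
  by rewrite fl.
have eW_irr w : eW w w = 0.
  by apply/eqP; apply: contraT => /eWq; rewrite eqxx.
have [||||Q [Qs Qc Qg] Qa] := @partite_construction A (@dist A) W
    (fun w w' l => eW w w' = l) (@dist_sym A) (@dist_eq0 A) K k0
    (fun P => good tri n.+1 (@plabel _ P)) _ B (@dist B)
    (@dist_sym B) (@dist_eq0 B) embb (copy_of_B eW q) embb_dist _ _ _ arr.
- move=> P alpha k [Ps Pc Pg] [ai ac].
  exact: (good_step trialg (@dist_sym A) (@dist_eq0 A) A_tri eW_irr eWg).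
- by move=> beta /andP[/forallP H _] x y _; have /forallP/(_ y)/eqP := H x.
- move=> beta /andP[/forallP H _] x y E; apply: dist_id.
  by have /forallP/(_ y)/eqP <- := H x; rewrite E eW_irr.
- by apply: good_disjoint => //; exact: dist_eq0.
exists Q, (@plabel _ Q), r, (q \o @pproj _ Q); split=> //.
  by move=> x y xy; apply: eWq; rewrite (Qc _ _ xy).
move=> chi; have [f [fl /andP[_ fp]] fm] := Qa chi; exists f => //.
apply/andP; split; first by apply/forallP => x; apply/forallP => y; rewrite fl.
congr (increasing _ _): fp; apply/ffunP => x; by rewrite !ffunE.
Qed.

End GoodArrow.

(** * Completion *)

Section Completion.

Variables (d K1 K2 c0 c1 C M : nat) (cIII : bool).
Hypothesis P : magic d K1 K2 c0 c1 C M cIII.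

Local Notation allowed := (allowed K1 K2 c0 c1).
Local Notation poss := (poss d K1 K2 c0 c1 C M cIII).
Local Notation dated := (dated d K1 K2 c0 c1 C M cIII).
Local Notation unforced := (unforced d C M).
Local Notation fork := (fork C M).

Definition tri (a b c : nat) : Prop :=
  (a <= d /\ b <= d /\ c <= d) /\ allowed a b c.

Lemma tri_algebra : label_algebra tri.
Proof.
split.
- by move=> a b c [? /allowed_rot ?]; split=> //; lia.
- by move=> a b c [? /allowed_swap ?]; split=> //; lia.
- move=> a b c e x [[ad [bd xd]] A1] [[_ [cd ed]] A2].
  have [y [yd ? ?]] := allowed_assoc P ad bd cd ed xd A1 A2.
  by exists y; split=> //; lia.
- by move=> a c [_ [? _]]; lia.
split; first by split=> //; apply: (allowed_refl P).
by move=> a b c [[? _] _]; split; [lia|apply: (allowed_refl P)].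
Qed.

Variables (V : finType) (e : V -> V -> nat).
Hypothesis e_sym : forall x y, e x y = e y x.
Hypothesis e_irr : forall x, e x x = 0.

Local Notation K := (2 * d).+1.
Hypothesis e_good : good tri (3 * 2 ^ K) e.

Local Notation edge := (fun x y => e x y != 0).

Definition forkb (a x y : nat) : bool :=
  (a < M) && ((x + y == a) || (x + y + a + 1 == C)) ||
  (M < a) && ((x == y + a) || (y == x + a)).

Lemma forkP a x y : reflect (fork a x y) (forkb a x y).
Proof.
apply: (iffP orP); rewrite /fork.
  by case=> /andP[? /orP[/eqP ?|/eqP ?]]; lia.
by case=> -[-> [->|->]]; rewrite ?eqxx ?orbT; auto.
Qed.

(* The label handled at time [k]; [0] when there is none. *)
Definition lab (k : nat) : nat :=
  if odd k then (if k./2.+1 < M then k./2.+1 else 0)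
  else (if M < d - k./2 then d - k./2 else 0).

Fixpoint stage (k : nat) : V -> V -> nat :=
  if k is k'.+1 then fun u v =>
    if stage k' u v != 0 then stage k' u v
    else if [&& u != v, 0 < lab k' &
             [exists w, [&& stage k' u w != 0, stage k' w v != 0 &
                            forkb (lab k') (stage k' u w) (stage k' w v)]]]
    then lab k' else 0
  else e.

Definition complete (u v : V) : nat :=
  if u == v then 0 else if stage K u v == 0 then M else stage K u v.

Lemma stage_sym k u v : stage k u v = stage k v u.
Proof.
elim: k u v => [|k IH] u v /=; first exact: e_sym.
have E x y : [exists w, [&& stage k x w != 0, stage k w y != 0 &
                  forkb (lab k) (stage k x w) (stage k w y)]] ->
  [exists w, [&& stage k y w != 0, stage k w x != 0 &
                  forkb (lab k) (stage k y w) (stage k w x)]].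
  move=> /existsP[w /and3P[xw wy /forkP F]]; apply/existsP; exists w.
  by rewrite (IH y w) (IH w x) xw wy; apply/forkP/fork_sym.
have E' := (E u v, E v u); rewrite (IH u v) (eq_sym u v).
by move: E'; case: existsP => ?; case: existsP => ? [E1 E2] //;
  [have := E1 isT|have := E2 isT].
Qed.

Lemma stage_keep j k u v : j <= k -> stage j u v != 0 -> stage k u v = stage j u v.
Proof.
by move=> /subnK <-; elim: (k - j) => //= i IH N; rewrite IH // N.
Qed.

Lemma edge_bound u v : e u v <= d.
Proof.
have [->//|uv] := eqVneq (e u v) 0.
have /= [] := @e_good [:: u; v].
- have : 0 < 2 ^ K by rewrite expn_gt0.
  lia.
- by rewrite /= uv e_sym uv.
by move=> x _ [[]].
Qed.

Lemma lab_bound k : lab k <= d.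
Proof. by rewrite /lab; have := P; case: ifP => _; case: ifP => // *; case: P; lia. Qed.

Lemma stage_bound k u v : stage k u v <= d.
Proof.
elim: k u v => [|k IH] u v /=; first exact: edge_bound.
by case: ifP => // _; case: ifP => // _; apply: lab_bound.
Qed.

(** A new label unfolds into the concatenated walks of its fork, so the length at most doubles at
    each stage, and [poss_fork] transfers the information on distances. *)
Lemma stage_walk k u v : stage k u v != 0 ->
  exists s, [/\ path edge u s, last u s = v, size s <= 2 ^ k &
    forall c, reach tri (pairmap e u s) c ->
      poss (stage k u v) c /\ (e u v != 0 -> c = e u v)].
Proof.
elim: k u v => [|k IH] u v /=.
  move=> uv; exists [:: v]; rewrite /= uv; split=> // c [x -> [_ [? _]]].
  have -> : c = e u v by lia.
  by split=> //; apply: poss_refl.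
case: ifP => [uv _|/negbFE/eqP uv].
  have [s [s1 s2 s3 s4]] := IH u v uv; exists s; split=> //.
  by apply: leq_trans s3 _; rewrite leq_exp2l.
case: ifP => [/and3P[Nuv lk /existsP[w /and3P[uw wv /forkP F]]] _|//].
have [s [s1 s2 s3 s4]] := IH u w uw; have [t [t1 t2 t3 t4]] := IH w v wv.
exists (s ++ t); rewrite cat_path last_cat s2 s1 t1 size_cat; split=> //.
  by rewrite expnS mul2n -addnn leq_add.
move=> c; rewrite pairmap_cat s2 => /(reach_catE tri_algebra).
move=> [x [y [/s4[px _] /t4[py _] [[? [? ?]] T]]]].
split; last by move=> E; move: (stage_keep (leq0n k) E); rewrite uv /= => E';
  rewrite -E' eqxx in E.
have := stage_bound k u w; have := stage_bound k w v; have := lab_bound k => ? ? ?.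
by apply: (poss_fork P _ _ _ _ _ _ px py T F); rewrite ?lt0n ?uw ?wv -?lt0n ?lk.
Qed.

Lemma complete_sym u v : complete u v = complete v u.
Proof. by rewrite /complete eq_sym stage_sym. Qed.

Lemma magic_bounds : 0 < M <= d.
Proof. by case: P; lia. Qed.

Lemma complete_bound u v : complete u v <= d.
Proof.
rewrite /complete; case: eqP => // _; case: eqP => _; last exact: stage_bound.
by have := magic_bounds; lia.
Qed.

Lemma complete_gt0 u v : u != v -> 0 < complete u v.
Proof.
rewrite /complete => /negPf->; case: eqVneq => [_|]; last by rewrite lt0n.
by have := magic_bounds; lia.
Qed.

Lemma complete_edge u v : e u v != 0 -> complete u v = e u v.
Proof.
move=> uv; have N : u != v by apply: contraNneq uv => ->; rewrite e_irr.
by rewrite /complete (negPf N) (stage_keep (leq0n _) uv) /= (negPf uv).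
Qed.

Definition dated_edge u v T :=
  (T = 0 /\ e u v != 0) \/
  (0 < T /\ ((complete u v < M /\ T = 2 * complete u v) \/
             (M < complete u v /\ T = 2 * (d - complete u v) + 1)) /\
   stage K u v != 0) \/
  (complete u v = M /\ T = 2 * d + 2).

Lemma timeline u v : u != v -> exists T,
  [/\ forall k, k < T -> k <= K -> stage k u v = 0,
      forall k, T <= k -> k <= K -> stage k u v = complete u v &
      dated_edge u v T].
Proof.
move=> Nuv; have cE : complete u v = if stage K u v == 0 then M else stage K u v.
  by rewrite /complete (negPf Nuv).
have [uv|uv] := eqVneq (e u v) 0; last first.
  exists 0; split=> //; last by left.
  by move=> k _ _; rewrite (stage_keep (leq0n k) uv) (complete_edge uv).
have [z|nz] := eqVneq (stage K u v) 0.
  exists (2 * d + 2); split; [|lia|by right; right; rewrite cE z].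
  move=> k _ kK; apply/eqP; apply: contraT => kn.
  by move: (stage_keep kK kn); rewrite z => E; rewrite -E eqxx in kn.
have exT : exists k, stage k u v != 0 by exists K.
have [T Tn Tmin] := ex_minnP exT.
have TK : T <= K by apply: Tmin.
exists T; split.
- by move=> k kT _; apply/eqP; apply: contraTT kT => /Tmin; rewrite -leqNgt.
- move=> k Tk kK; rewrite (stage_keep Tk Tn) cE (negPf nz).
  by rewrite (stage_keep TK Tn).
right; left; rewrite nz cE (negPf nz) (stage_keep TK Tn).
case: T Tn Tmin TK => [|T] Tn Tmin TK; first by rewrite /= uv eqxx in Tn.
split=> //; split=> //.
have z : stage T u v = 0.
  by apply/eqP; apply: contraT => /Tmin; rewrite ltnn.
move: Tn; rewrite /= z eqxx /=; case: ifP => // /and3P[_ lT _] _.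
move: lT; rewrite /lab; case: ifP => oT; case: ifP => // H _.
  by left; split=> //; lia.
by right; split=> //; lia.
Qed.

(** A fork whose legs are present at stage [k] would have labelled the pair at stage [k.+1]. *)
Lemma complete_unforced u v w Tu Tv Tw :
  u != v -> u != w -> w != v ->
  (forall k, k < Tu -> k <= K -> stage k u v = 0) ->
  (forall k, Tv <= k -> k <= K -> stage k u w = complete u w) ->
  (forall k, Tw <= k -> k <= K -> stage k w v = complete w v) ->
  unforced Tu Tv Tw (complete u w) (complete w v).
Proof.
move=> uv uw wv Hu Hv Hw x k xd kx Tvk Twk kTu F.
have lx : lab k = x.
  by move: xd kx; clear; rewrite /lab => xd kx; case: ifP => ok; case: ifP => H; lia.
have kK : k < K by lia.
have := Hu _ kTu kK; rewrite /= Hu //; last exact: ltnW; last exact: ltnW.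
rewrite eqxx /= uv lx.
case: ifP => [_|]; first by lia.
move=> /negP[]; apply/and3P; split=> //; first by case/andP: xd.
apply/existsP; exists w; rewrite Hv // ?Hw //; try exact: ltnW.
by rewrite -!lt0n !complete_gt0 //=; apply/forkP.
Qed.

Lemma reach_exists x s : exists c, reach tri (pairmap e x s) c.
Proof.
elim: s x => [|y s IH] x /=; first by exists 0.
(* The difference closes a degenerate triangle, whose perimeter is even and at most [2 * d]. *)
have [c r] := IH y; exists (maxn (e x y) c - minn (e x y) c), c => //.
have cd : c <= d by have [] := reach_refl tri_algebra r; lia.
have := edge_bound x y => ed.
split; first lia.
by split; [lia|exists (maxn (e x y) c); left; case: P => ? [? [? _]]; lia].
Qed.

Lemma dated_walk u v T : u != v -> dated_edge u v T ->
  (exists s, [/\ path edge u s, last u s = v, size s <= 2 ^ K &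
     forall c, reach tri (pairmap e u s) c -> dated (complete u v) T c]) \/
  forall c, dated (complete u v) T c.
Proof.
move=> uv; case=> [[T0 euv]|[[T0 [Tt nz]]|?]]; last by right=> c; right; right.
- left; exists [:: v]; rewrite /= euv expn_gt0; split=> // c [x -> [_ [? _]]].
  by left; rewrite (complete_edge euv); lia.
left; have [s [s1 s2 s3 s4]] := stage_walk nz; exists s; split=> // c /s4[pc _].
have cE : complete u v = stage K u v by rewrite /complete (negPf uv) (negPf nz).
by right; left; rewrite {1}cE.
Qed.

(** The walks of the three sides form a closed walk of length at most [3 * 2 ^ K]. It is good, so it
    yields a triangle of distances. A pair filled with [M] accepts every distance, and then a
    degenerate triangle suffices. *)
Lemma dated_triangle u v w Tuv Tvw Tuw : u != v -> v != w -> u != w ->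
  dated_edge u v Tuv -> dated_edge v w Tvw -> dated_edge u w Tuw ->
  exists a b c, [/\ dated (complete u v) Tuv a, dated (complete v w) Tvw b,
      dated (complete u w) Tuw c & tri a b c].
Proof.
have [rot swap _ id0 [t0 refl]] := tri_algebra.
have third a b : a <= d -> b <= d -> exists c, tri a b c.
  move=> ad bd; exists (maxn a b - minn a b); split; first lia.
  by split; [lia|exists (maxn a b); left; case: P => ? [? [? _]]; lia].
have single x y T : x != y -> dated_edge x y T ->
  exists2 c, c <= d & dated (complete x y) T c.
  move=> xy /(dated_walk xy)[[s [_ _ _ H]]|H]; last by exists 0.
  have [c r] := reach_exists x s; exists c; last exact: H.
  by have [] := reach_refl tri_algebra r; lia.
move=> uv vw uw Duv Dvw Duw.
have [a ad Da] := single _ _ _ uv Duv.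
have [b bd Db] := single _ _ _ vw Dvw.
have [c cd Dc] := single _ _ _ uw Duw.
case: (dated_walk uv Duv) => [[s [s1 s2 s3 s4]]|H]; last first.
  have [x t] := third b c bd cd; exists x, b, c; split=> //.
  exact: (rot _ _ _ (rot _ _ _ t)).
case: (dated_walk vw Dvw) => [[t [t1 t2 t3 t4]]|H]; last first.
  have [x t] := third a c ad cd; exists a, x, c; split=> //.
  exact: (swap _ _ _ (rot _ _ _ (rot _ _ _ t))).
have wu : w != u by rewrite eq_sym.
have Dwu : dated_edge w u Tuw.
  by move: Duw; rewrite /dated_edge !(complete_sym u w) stage_sym e_sym.
case: (dated_walk wu Dwu) => [[z [z1 z2 z3 z4]]|H]; last first.
  by have [x t'] := third a b ad bd; exists a, b, x; split=> //; rewrite complete_sym.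
case/lastP: z z1 z2 z3 z4 => [_ /= E|z u' z1 z2 z3 z4].
  by rewrite E eqxx in wu.
rewrite last_rcons in z2; rewrite {u'}z2 in z1 z3 z4.
have cyc : cycle edge (u :: s ++ t ++ z).
  by rewrite /= !rcons_cat !cat_path s2 t2 s1 t1 z1.
have sz : size (u :: s ++ t ++ z) <= 3 * 2 ^ K.
  move: z3; rewrite /= !size_cat size_rcons; move: s3 t3; clear.
  move: (2 ^ K) (size s) (size t) (size z); lia.
have := e_good sz cyc; rewrite /= !rcons_cat !pairmap_cat s2 t2 catA.
move=> /(reach_closedE tri_algebra)[x /(reach_catE tri_algebra)[a1 [b1 [r1 r2 tr]]] r3].
exists a1, b1, x; split=> //; [exact: s4|exact: t4|].
by rewrite complete_sym; apply: z4.
Qed.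

Theorem complete_tri u v w : tri (complete u v) (complete v w) (complete u w).
Proof.
have [rot swap _ id0 [t0 refl]] := tri_algebra.
have cxx x : complete x x = 0 by rewrite /complete eqxx.
have tz a : a <= d -> tri a a 0.
  by move=> ad; split; [lia|apply: (allowed_refl P)].
have [->|uv] := eqVneq u v.
  by rewrite cxx; exact: (rot _ _ _ (rot _ _ _ (tz _ (complete_bound _ _)))).
have [<-|vw] := eqVneq v w.
  by rewrite cxx; exact: (rot _ _ _ (tz _ (complete_bound _ _))).
have [<-|uw] := eqVneq u w.
  by rewrite cxx (complete_sym v); apply: tz; apply: complete_bound.
split; first by rewrite !complete_bound.
have vu : v != u by rewrite eq_sym.
have wu : w != u by rewrite eq_sym.
have wv : w != v by rewrite eq_sym.
have [Tuv [Auv Buv Cuv]] := timeline uv.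
have [Tvw [Avw Bvw Cvw]] := timeline vw.
have [Tuw [Auw Buw Cuw]] := timeline uw.
have [a' [b' [c' [Duv Dvw Duw /proj2 T]]]] : exists a' b' c',
  [/\ dated (complete u v) Tuv a', dated (complete v w) Tvw b',
      dated (complete u w) Tuw c' & tri a' b' c'].
  exact: dated_triangle.
have flip x y Txy : (forall k, k < Txy -> k <= K -> stage k x y = 0) ->
  forall k, k < Txy -> k <= K -> stage k y x = 0.
  by move=> H k k1 k2; rewrite stage_sym H.
have flip' x y Txy : (forall k, Txy <= k -> k <= K -> stage k x y = complete x y) ->
  forall k, Txy <= k -> k <= K -> stage k y x = complete y x.
  by move=> H k k1 k2; rewrite stage_sym H // complete_sym.
have pos x y : x != y -> 0 < complete x y <= d.
  by move=> xy; rewrite complete_gt0 // complete_bound.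
apply: (completed_allowed P (pos _ _ uv) (pos _ _ vw) (pos _ _ uw) Duv Dvw Duw _ _ _ T).
- rewrite (complete_sym v w); apply: unforced_sym.
  exact: (complete_unforced uv uw wv Auv Buw (flip' _ _ _ Bvw)).
- rewrite (complete_sym u v).
  exact: (complete_unforced vw vu uw Avw (flip' _ _ _ Buv) Buw).
exact: (complete_unforced uw uv vw Auw Buv Bvw).
Qed.

End Completion.

(** * The class *)

Section MagicClass.

Variables (d K1 K2 c0 c1 C M : nat) (cIII : bool).
Hypothesis P : magic d K1 K2 c0 c1 C M cIII.

Local Notation tri := (tri d K1 K2 c0 c1).
Local Notation classA := (in_classA d K1 K2 (2 * c0) (2 * c1 + 1)).

Let d_lt_c0 : d < c0. Proof. by case: P => ? [? [? _]]; lia. Qed.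

Lemma classA_tri (X : intMetric) :
  classA X <-> forall x y z : X, tri (dist x y) (dist y z) (dist x z).
Proof.
rewrite allowed_classA //; split=> H x y z.
  have [xy al] := H x y z; have [yz _] := H y z z; have [xz _] := H x z z.
  by split.
by have [[? _] ?] := H x y z.
Qed.

Section TriMetric.

Variables (T : finType) (D : T -> T -> nat).
Hypotheses (D_eq0 : forall x y, D x y = 0 <-> x = y) (D_sym : forall x y, D x y = D y x).
Hypothesis D_tri : forall x y z, tri (D x y) (D y z) (D x z).

Lemma tri_triangle x y z : D x z <= D x y + D y z.
Proof. by have [_ [? _]] := D_tri x y z; lia. Qed.

Definition tri_metric : intMetric := IntMetric D_eq0 D_sym tri_triangle.

Lemma tri_metric_classA : classA tri_metric.
Proof. exact/classA_tri. Qed.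

End TriMetric.

(** Goodness up to [3 * 2 ^ (2 * d).+1] is what the completion needs; as it keeps given edges, the
    copies of [B] survive. *)
Theorem classA_ramsey : ramsey (free_orderings classA).
Proof.
move=> A B [/classA_tri At Al] [/classA_tri Bt Bl] k k1.
have [V [e [r [q [es eq eg arr]]]]] :=
  good_arrow_exists (tri_algebra P) Al Bl At Bt (Ordinal k1) (3 * 2 ^ (2 * d).+1).
have e_irr x : e x x = 0 by apply/eqP; apply: contraT => /eq; rewrite eqxx.
pose D := complete d C M e.
have D0 x y : D x y = 0 <-> x = y.
  split=> [|->]; last by rewrite /D /complete eqxx.
  have [//|xy] := eqVneq x y.
  by have := complete_gt0 P e xy; rewrite -/D; lia.
have Dt := complete_tri P es e_irr eg.
pose X := tri_metric D0 (complete_sym d C M es) Dt.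
(* Points are ordered by level, with ties broken by the enumeration. *)
pose key (x : V) := q x * #|V| + enum_rank x.
have key_lt x y : q x < q y -> key x < key y.
  move=> xy; rewrite /key; have := ltn_ord (enum_rank x) => rx.
  apply: (@leq_trans ((q x).+1 * #|V|)).
    by rewrite mulSn addnC -addSn leq_add2r.
  exact: leq_trans (leq_mul xy (leqnn _)) (leq_addr _ _).
have key_inj : injective key.
  move=> x y E; case: (ltngtP (q x) (q y)) => [/key_lt|/key_lt|E']; rewrite ?E ?ltnn //.
  by apply: enum_rank_inj; apply: val_inj; move: E; rewrite /key E' => /addnI.
pose le (x y : X) := key x <= key y.
have le_lin : linear_order le.
  split=> [x y|y x z|x y]; first by rewrite -eqn_leq => /eqP/key_inj.
    exact: leq_trans.
  exact: leq_total.
exists (Expand le); split; first by split=> //; apply: tri_metric_classA.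
move=> chi; have [f /andP[/forallP fd /increasingP fq] fm] :=
  arr (fun h : {ffun A -> V} => chi [set h a | a : A]).
have fE x y : e (f x) (f y) = dist x y by have /forallP/(_ y)/eqP := fd x.
have fD x y : D (f x) (f y) = dist x y.
  have [->|xy] := eqVneq x y; first by rewrite (proj2 (D0 _ _) erefl) distxx.
  rewrite /D (complete_edge d C M e_irr) fE //; apply: contraNneq xy => xy0.
  by rewrite (dist_id xy0).
have fi : injective f by move=> x y E; apply: dist_id; rewrite -fD E; apply/D0.
have [_ _ Btot] := Bl.
have fle x y : le (f x) (f y) = ordle x y.
  have [->|xy] := eqVneq x y.
    by rewrite /le leqnn; have := Btot y y; rewrite orbb.
  have [xy'|/negPf xyN] := boolP (ordle x y).
    by have := fq _ _ xy xy'; rewrite !ffunE => /key_lt/ltnW.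
  have yx : ordle y x by have := Btot x y; rewrite xyN.
  have := fq y x; rewrite eq_sym xy !ffunE => /(_ isT yx)/key_lt lt.
  by rewrite /le leqNgt lt.
have femb : @embedding B (Expand le) f by split.
exists [set f x | x : B]; split; first by exists f.
(* Copies of [A] inside the copy of [B] factor through embeddings of [A] into [B], so the arrow for
   maps yields the statement for sets. *)
have factor (S : {set Expand le}) : S \subset [set f x | x : B] ->
  @is_copy A (Expand le) S ->
  exists2 g, embb g & S = [set comp_ffun f g a | a : A].
  move=> Ssub [h [[hi hd hl] hS]].
  have [g gP] : exists g : A -> B, forall a, h a = f (g a).
    apply: (@fin_all_exists _ _ (fun a x => h a = f x)) => a.
    have : h a \in S by rewrite -hS; apply: imset_f.
    by move=> /(subsetP Ssub)/imsetP[x _ ->]; exists x.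
  exists (finfun g).
    apply/embbP => a b; rewrite !ffunE; split.
      by rewrite -fD -!gP; exact: hd.
    by rewrite -fle -!gP; exact: hl.
  by rewrite -hS; apply: eq_imset => a; rewrite !ffunE.
move=> S1 S2 /factor H1 /H1[g1 e1 ->] /factor H2 /H2[g2 e2 ->].
exact: fm.
Qed.

(** * Joint embedding and the expansion property *)

Definition two_point_dist (a : nat) (x y : bool) : nat := if x == y then 0 else a.

Lemma tri_diag a : a <= d -> [/\ tri a a 0, tri a 0 a & tri 0 a a].
Proof.
have [rot _ _ _ _] := tri_algebra P.
move=> ad; have t : tri a a 0 by split; [lia|apply: (allowed_refl P)].
by split=> //; [exact: rot|exact: (rot _ _ _ (rot _ _ _ t))].
Qed.

Lemma tri_magic a : a <= d -> [/\ tri a M M, tri M a M & tri M M a].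
Proof.
have [rot _ _ _ _] := tri_algebra P.
move=> ad; have t : tri a M M.
  by case: (P) => ? [? _]; split; [lia|apply: (allowed_magic P); lia].
by split=> //; [exact: (rot _ _ _ (rot _ _ _ t))|exact: rot].
Qed.

Lemma two_point_exists a : 0 < a <= d -> exists E : expansion,
  free_orderings classA E /\
  exists x y : E, [/\ forall z, z = x \/ z = y, dist x y = a, ordle x y & x != y].
Proof.
move=> /andP[a0 ad]; have [t1 t2 t3] := tri_diag ad; have [t4 _ _] := tri_diag (leq0n d).
have D0 x y : two_point_dist a x y = 0 <-> x = y.
  by rewrite /two_point_dist; case: eqP => // N; split=> // E; lia.
have Ds x y : two_point_dist a x y = two_point_dist a y x.
  by rewrite /two_point_dist eq_sym.
have Dt x y z : tri (two_point_dist a x y) (two_point_dist a y z) (two_point_dist a x z).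
  by case: x y z => [] [] [].
exists (@Expand (tri_metric D0 Ds Dt) implb); split.
  by split; [exact: tri_metric_classA|split=> [[] []|[] [] []|[] []]].
by exists false, true; split=> //; case; [right|left].
Qed.

(** All cross distances are [M], so every new triangle has sides [M], [M], [a]. *)
Lemma sum_exists (X Y : expansion) :
  free_orderings classA X -> free_orderings classA Y ->
  exists Z, [/\ free_orderings classA Z, embeds X Z & embeds Y Z].
Proof.
move=> [/classA_tri Xt [Xa Xtr Xto]] [/classA_tri Yt [Ya Ytr Yto]].
pose D (u v : X + Y) : nat := match u, v with
  | inl x, inl x' => dist x x' | inr y, inr y' => dist y y' | _, _ => M end.
pose le (u v : X + Y) : bool := match u, v with
  | inl x, inl x' => ordle x x' | inr y, inr y' => ordle y y'
  | inl _, inr _ => true | inr _, inl _ => false end.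
have M0 : 0 < M by have := magic_bounds P; lia.
have D0 u v : D u v = 0 <-> u = v.
  case: u v => [x|y] [x'|y'] /=; try by split=> // E; lia.
    by rewrite dist_eq0; split=> [->|[->]].
  by rewrite dist_eq0; split=> [->|[->]].
have Ds u v : D u v = D v u by case: u v => [x|y] [x'|y'] //=; exact: dist_sym.
have Dt u v w : tri (D u v) (D v w) (D u w).
  case: u v w => [x|y] [x'|y'] [x''|y''] //=.
  - by have [[xd _] _] := Xt x x' x'; have [] := tri_magic xd.
  - by have [[xd _] _] := Xt x x'' x''; have [] := tri_magic xd.
  - by have [[xd _] _] := Yt y' y'' y''; have [] := tri_magic xd.
  - by have [[xd _] _] := Xt x' x'' x''; have [] := tri_magic xd.
  - by have [[xd _] _] := Yt y y'' y''; have [] := tri_magic xd.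
  by have [[xd _] _] := Yt y y' y'; have [] := tri_magic xd.
exists (@Expand (tri_metric D0 Ds Dt) le); split.
- split; first exact: tri_metric_classA.
  split.
  + by move=> [x|y] [x'|y'] //= H; congr (_ _); [exact: Xa|exact: Ya].
  + by move=> [x|y] [x'|y'] [x''|y''] //=; do ?[exact: Xtr|exact: Ytr].
  by move=> [x|y] [x'|y'] //=; do ?[exact: Xto|exact: Yto].
- by exists inl; split=> // x y [].
by exists inr; split=> // x y [].
Qed.

Lemma embeds_trans (X Y Z : expansion) : embeds X Y -> embeds Y Z -> embeds X Z.
Proof.
move=> [f [fi fd fl]] [g [gi gd gl]]; exists (g \o f); split=> /=.
- exact: inj_comp.
- by move=> x y; rewrite gd fd.
by move=> x y; rewrite gl fl.
Qed.

Lemma joint_exists (I : eqType) (F : I -> expansion) (s : seq I) :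
  (forall i, i \in s -> free_orderings classA (F i)) ->
  exists Z, free_orderings classA Z /\ forall i, i \in s -> embeds (F i) Z.
Proof.
elim: s => [_|i s IH H].
  have [|E [KE _]] := @two_point_exists 1; last by exists E.
  by have := magic_bounds P; lia.
have [j js|Z [KZ eZ]] := IH; first by apply: H; rewrite inE js orbT.
have [Y [KY iY ZY]] := sum_exists (H i (mem_head _ _)) KZ.
exists Y; split=> // j; rewrite inE => /predU1P[->//|/eZ jZ].
exact: embeds_trans jZ ZY.
Qed.

Lemma triangle_exists a : 0 < a <= d -> exists E : expansion,
  free_orderings classA E /\
  exists x y z : E, [/\ dist x y = M, dist y z = M, dist x z = a &
    [/\ ordle x y, ordle y z, ordle x z & [/\ x != y, y != z & x != z]]].
Proof.
move=> /andP[a0 ad].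
have /andP[M0 Md] := magic_bounds P.
have [t1 t2 t3] := tri_diag ad; have [t4 _ _] := tri_diag (leq0n d).
have [t5 t6 t7] := tri_diag Md; have [t8 t9 t10] := tri_magic ad.
pose D (u v : option bool) : nat := match u, v with
  | Some x, Some y => two_point_dist a x y | None, None => 0 | _, _ => M end.
pose le (u v : option bool) : bool := match u, v with
  | Some x, Some y => x ==> y | None, None => true
  | None, Some y => y | Some x, None => ~~ x end.
have D0 u v : D u v = 0 <-> u = v.
  by case: u v => [[]|] [[]|] //; split=> // E; exfalso; move: E;
     rewrite /D /two_point_dist /=; lia.
have Ds u v : D u v = D v u by case: u v => [[]|] [[]|].
have Dt u v w : tri (D u v) (D v w) (D u w) by case: u v w => [[]|] [[]|] [[]|].
exists (@Expand (tri_metric D0 Ds Dt) le); split.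
  by split; [exact: tri_metric_classA|
             split=> [[[]|] [[]|]|[[]|] [[]|] [[]|]|[[]|] [[]|]]].
by exists (Some false), None, (Some true).
Qed.

(** One Ramsey step for the two-point space of each distance. The copy of [Y1] settles the remaining
    distances, and the copy of [X] inside it inherits them. *)
Lemma monochromatic_distances (l : seq nat) (X : expansion) :
  (forall a, a \in l -> 0 < a <= d) -> free_orderings classA X ->
  exists Y, free_orderings classA Y /\ forall s : rel Y,
    exists2 f : X -> Y, embedding f & forall a, a \in l -> exists eps : bool,
      forall x y, x != y -> ordle x y -> dist x y = a -> s (f x) (f y) = eps.
Proof.
elim: l X => [|a l IH] X Hl KX.
  by exists X; split=> // s; exists id => [|a]; [split|rewrite in_nil].
have [E [KE [p1 [p2 [Ep Ed Eo Epp]]]]] := two_point_exists (Hl a (mem_head _ _)).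
have [Y1 [KY1 HY1]] := classA_ramsey KE KX (isT : 1 <= 2).
have [|Y [KY HY]] := IH Y1 _ KY1.
  by move=> b bl; apply: Hl; rewrite inE bl orbT.
exists Y; split=> // s; have [f1 f1e f1l] := HY s.
pose chi (S : {set Y1}) : 'I_2 := inord [exists x in S, exists y in S,
   [&& x != y, ordle x y & s (f1 x) (f1 y)]].
have [S [[f0 [f0e f0S]] mono]] := HY1 chi.
have [f0i f0d f0o] := f0e; have [f1i f1d f1o] := f1e.
exists (f1 \o f0).
  by split=> [|x y|x y] /=; rewrite ?f1d ?f1o ?f0d ?f0o //; apply: inj_comp.
move=> b; rewrite inE => /predU1P[->|bl]; last first.
  have [eps H] := f1l b bl; exists eps => x y xy oxy dxy.
  by apply: H; rewrite ?f0d ?f0o // (inj_eq f0i).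
have [Y1a _ _] := KY1.2.
have pairC x y : x != y -> ordle x y -> dist x y = a ->
  [/\ [set f0 x; f0 y] \subset S, is_copy E [set f0 x; f0 y] &
      chi [set f0 x; f0 y] = inord (s (f1 (f0 x)) (f1 (f0 y)))].
  move=> xy oxy dxy; split.
  - by apply/subsetP => z; rewrite -f0S !inE => /orP[]/eqP->; apply: imset_f.
  - exists (fun p => if p == p1 then f0 x else f0 y).
    have [_ _ KEt] := KE.2; have [_ _ KXt] := KX.2; have [KEa _ _] := KE.2;
      have [KXa _ _] := KX.2.
    have oE (Z : expansion) (u : Z) : total (@ordle Z) -> ordle u u.
      by move=> t; have := t u u; rewrite orbb.
    have N1 : ordle p2 p1 = false.
      by apply: contraNF Epp => H; apply/eqP; apply: KEa; rewrite Eo.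
    have N2 : ordle y x = false.
      by apply: contraNF xy => H; apply/eqP; apply: KXa; rewrite oxy.
    have P21 : (p2 == p1) = false by rewrite eq_sym (negPf Epp).
    split; first split.
    + move=> u v; case: (Ep u) (Ep v) => -> [->|->]; rewrite ?eqxx ?P21 // => /f0i E';
        by rewrite E' eqxx in xy.
    + move=> u v; case: (Ep u) (Ep v) => -> [->|->]; rewrite ?eqxx ?P21 f0d ?distxx //.
        by rewrite dxy.
      by rewrite dist_sym dxy dist_sym.
    + move=> u v; case: (Ep u) (Ep v) => -> [->|->]; rewrite ?eqxx ?P21 f0o ?oE //.
        by rewrite oxy.
      by rewrite N1.
    apply/setP => z; rewrite !inE; apply/imsetP/orP.
      by move=> [u _ ->]; case: ifP => _; [left|right]; apply/eqP.
    case=> /eqP->; first by exists p1; rewrite ?eqxx.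
    by exists p2; rewrite ?P21.
  congr inord; congr nat_of_bool; apply/idP/idP.
    move=> /existsP[u /andP[uS /existsP[v /andP[vS /and3P[uv ouv suv]]]]].
    move: uS vS; rewrite !inE => /orP[]/eqP uE /orP[]/eqP vE;
      rewrite uE vE ?eqxx // in uv ouv suv *.
    case/negP: uv; apply/eqP; apply: Y1a; rewrite ouv f0o oxy //.
  move=> sxy; apply/existsP; exists (f0 x); rewrite !inE eqxx /=.
  apply/existsP; exists (f0 y); rewrite !inE eqxx orbT /= (inj_eq f0i) xy f0o oxy.
  exact: sxy.
have [/existsP[x0 /existsP[y0 /and3P[xy0 oxy0 /eqP dxy0]]]|N] :=
  boolP [exists x : X, exists y : X, [&& x != y, ordle x y & dist x y == a]].
  have [S0 C0 E0] := pairC x0 y0 xy0 oxy0 dxy0.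
  exists (s (f1 (f0 x0)) (f1 (f0 y0))) => x y xy oxy dxy /=.
  have [S1 C1 E1] := pairC x y xy oxy dxy.
  have := mono _ _ S1 C1 S0 C0; rewrite E0 E1 => /(congr1 (@nat_of_ord 2)).
  by rewrite !inordK; [case: (s _ _); case: (s _ _)|case: (s _ _)|case: (s _ _)].
(* For a distance that does not occur in [X] any sign works. *)
exists true => x y xy oxy dxy; case/negP: N; apply/existsP; exists x.
by apply/existsP; exists y; rewrite xy oxy dxy eqxx.
Qed.

(** A boolean form lets the finitely many linear orders of a space be listed. *)
Definition linearb (T : finType) (r : rel T) : bool :=
  [forall x, forall y, (r x y && r y x ==> (x == y)) && (r x y || r y x) &&
    [forall z, r x y && r y z ==> r x z]].

Lemma linearP (T : finType) (r : rel T) : reflect (linear_order r) (linearb r).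
Proof.
apply: (iffP forallP) => [H|[ra rt rto] x].
  have H' x y := forallP (H x) y.
  split=> [x y xy|y x z xy yz|x y];
    have /andP[/andP[/implyP h1 h2] /forallP h3] := H' x y => //.
    exact/eqP/h1.
  by have /implyP := h3 z; apply; rewrite xy.
apply/forallP => y; rewrite rto andbT; apply/andP; split.
  by apply/implyP => /ra ->.
by apply/forallP => z; apply/implyP => /andP[]; apply: rt.
Qed.

Lemma linear_order_rev (T : Type) (r : rel T) :
  linear_order r -> linear_order (fun x y => r y x).
Proof.
move=> [ra rt rto]; split=> [x y|y x z xy yz|x y]; last exact: rto.
  by rewrite andbC => /ra.
exact: rt yz xy.
Qed.

Theorem classA_expansion_property :
  expansion_property (free_orderings classA) classA.
Proof.
move=> A KA; have /andP[M0 Md] := magic_bounds P.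
pose ords := [seq t : {ffun A * A -> bool} <- enum {: {ffun A * A -> bool}} |
  linearb (fun x y : A => t (x, y))].
(* [B1] contains [A] under each of its linear orders; [B2] below supplies the ordered triangles that
   compare signs. *)
have [B1 [KB1 eB1]] : exists Z, free_orderings classA Z /\ forall t, t \in ords ->
    embeds (@Expand A (fun x y => t (x, y))) Z.
  by apply: joint_exists => t; rewrite mem_filter => /andP[/linearP lt _]; split.
have emb1 (r : rel A) : linear_order r -> embeds (@Expand A r) B1.
  move=> rl; have [|f [fi fd fl]] := eB1 [ffun p => r p.1 p.2].
    rewrite mem_filter mem_enum andbT; apply/linearP.
    have [ra rt rto] := rl.
    by split=> [x y|y x z|x y]; rewrite !ffunE; [exact: ra|exact: rt|exact: rto].
  by exists f; split=> // x y; rewrite fl /= ffunE.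
have [B2 [KB2 eB2]] : exists Z, free_orderings classA Z /\ forall a, 0 < a <= d ->
    exists x y z : Z, [/\ dist x y = M, dist y z = M, dist x z = a &
    [/\ ordle x y, ordle y z, ordle x z & [/\ x != y, y != z & x != z]]].
  have H (i : 'I_d) : exists E, free_orderings classA E /\
    exists x y z : E, [/\ dist x y = M, dist y z = M, dist x z = i.+1 &
    [/\ ordle x y, ordle y z, ordle x z & [/\ x != y, y != z & x != z]]].
    by apply: triangle_exists; rewrite ltnS ltn_ord.
  have [F FP] := fin_all_exists H.
  have [|Z [KZ eZ]] := @joint_exists _ F (enum 'I_d).
    by move=> i _; have [] := FP i.
  exists Z; split=> // a /andP[a0 ad].
  have ia : a.-1 < d by rewrite prednK.
  have [f [fi fd fl]] := eZ (Ordinal ia) (mem_enum _ _).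
  have [_ [x [y [z [d1 d2 d3 [o1 o2 o3 [n1 n2 n3]]]]]]] := FP (Ordinal ia).
  exists (f x), (f y), (f z); rewrite !fd !fl !(inj_eq fi) d1 d2 d3 o1 o2 o3 n1 n2 n3.
  by rewrite /= prednK.
have [B0 [KB0 [g1 [g1i g1d g1l]] [g2 [g2i g2d g2l]]]] := sum_exists KB1 KB2.
have Hl a : a \in iota 1 d -> 0 < a <= d by rewrite mem_iota; lia.
have [Y [KY HY]] := monochromatic_distances Hl KB0.
exists Y; split; first exact: KY.1.
move=> r s [_ rl] [_ sl].
have [f [fi fd fo] feps] := HY s.
have [sa st sto] : linear_order s := sl.
have epsP a : 0 < a <= d -> exists eps : bool,
  forall x y : B0, x != y -> ordle x y -> dist x y = a -> s (f x) (f y) = eps.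
  by move=> ad; apply: feps; rewrite mem_iota; lia.
have [eps HM] : exists eps : bool,
  forall x y : B0, x != y -> ordle x y -> dist x y = M -> s (f x) (f y) = eps.
  by apply: epsP; rewrite M0.
have [B0t [B0a _ B0to]] := KB0.
(* Transitivity of [s] along a triangle [M], [M], [a] carries the sign of [M] over to [a]; for the
   negative sign the reverse of [s] is used. *)
have Heps (x y : B0) : x != y -> ordle x y -> s (f x) (f y) = eps.
  move=> xy oxy; have xyd : 0 < dist x y <= d by exact: B0t.1.
  have [eps' He] := epsP _ xyd; rewrite (He x y) //.
  have [u [v [w [d1 d2 d3 [o1 o2 o3 [n1 n2 n3]]]]]] := eB2 _ xyd.
  have E1 : s (f (g2 u)) (f (g2 v)) = eps.
    by apply: HM; rewrite ?(inj_eq g2i) ?g2l ?g2d.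
  have E2 : s (f (g2 v)) (f (g2 w)) = eps.
    by apply: HM; rewrite ?(inj_eq g2i) ?g2l ?g2d.
  have E3 : s (f (g2 u)) (f (g2 w)) = eps'.
    by apply: He; rewrite ?(inj_eq g2i) ?g2l ?g2d.
  case: eps E1 E2 {HM} => E1 E2.
    by rewrite -E3; apply: st E1 E2.
  rewrite -E3; apply: contraNF n3 => uw.
  have vu : s (f (g2 v)) (f (g2 u)) by have := sto (f (g2 u)) (f (g2 v)); rewrite E1.
  have wv : s (f (g2 w)) (f (g2 v)) by have := sto (f (g2 v)) (f (g2 w)); rewrite E2.
  have wu := st _ _ _ wv vu.
  by rewrite -(inj_eq g2i) -(inj_eq fi); apply/eqP; apply: sa; rewrite uw.
have B0r (x : B0) : ordle x x by have := B0to x x; rewrite orbb.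
have sr y : s y y by have := sto y y; rewrite orbb.
case: eps Heps {HM} => Heps.
- have [h [hi hd hl]] := emb1 r rl.
  exists (f \o g1 \o h); split.
  + by apply: inj_comp => //; apply: inj_comp.
  + by move=> x y /=; rewrite -[RHS]hd -g1d -fd.
  move=> x y /=; rewrite -[RHS]hl -g1l.
  move: (g1 (h x)) (g1 (h y)) => u v.
  have [->|uv] := eqVneq u v; first by rewrite sr B0r.
  have [ouv|Nuv] := boolP (ordle u v); first exact: Heps.
  have ovu : ordle v u by have := B0to u v; rewrite (negPf Nuv).
  apply: contraNF Nuv => suv; have svu : s (f v) (f u) by apply: Heps; rewrite // eq_sym.
  by rewrite (fi u v) //; apply: sa; rewrite suv.
(* Here [s] reverses the order of [B0], so the reverse of [r] is embedded first. *)
have [h [hi hd hl]] := emb1 _ (linear_order_rev rl).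
exists (f \o g1 \o h); split.
+ by apply: inj_comp => //; apply: inj_comp.
+ by move=> x y /=; rewrite -[RHS]hd -g1d -fd.
move=> x y /=; rewrite -[RHS]/(@ordle (@Expand A (fun x y => r y x)) y x) -hl -g1l.
move: (g1 (h x)) (g1 (h y)) => u v.
have [->|uv] := eqVneq u v; first by rewrite sr B0r.
have [ovu|Nvu] := boolP (ordle v u).
  have svu : s (f v) (f u) = false by apply: Heps; rewrite // eq_sym.
  by have := sto (f u) (f v); rewrite svu orbF.
by apply: Heps => //; have := B0to u v; rewrite (negPf Nvu) orbF.
Qed.

End MagicClass.

Theorem theorem4p28 (delta K1 K2 C0 C1 : nat) :
  primitive_admissible delta K1 K2 C0 C1 ->
  ramsey (free_orderings (in_classA delta K1 K2 C0 C1)) /\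
  expansion_property (free_orderings (in_classA delta K1 K2 C0 C1))
                     (in_classA delta K1 K2 C0 C1).
Proof.
move=> /magic_exists[c0 [c1 [C [M [cIII [-> -> P]]]]]]; split.
  exact: (classA_ramsey P).
exact: (classA_expansion_property P).
Qed.
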